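(* Let $(X,\mu)$ be a standard Lebesgue measure space and let $\mathbb T=\{z\in\mathbb C: |z|=1\}$ be the circle group. The Polish group $L^0(X,\mu;\mathbb T)$ does not have property $(T)$, yet it has property $(OB)$.
   Context: A standard Lebesgue measure space is a standard Borel space with a diffuse (non-atomic) probability measure, e.g. $[0,1]$ with Lebesgue measure. $L^0(X,\mu;\mathbb T)$ is the group of all (equivalence classes of) measurable maps from $X$ to $\mathbb T$ with pointwise operations and the topology of convergence in measure. A strongly continuous unitary representation $\pi$ of a topological group $G$ has almost invariant vectors if for every $\varepsilon>0$ and every compact $K\subseteq G$ there is a unit vector $\xi$ with $\|\xi-\pi_g\xi\|<\varepsilon$ for all $g\in K$. $G$ has property $(T)$ if every strongly continuous unitary representation of $G$ having almost invariant vectors has an invariant unit vector. $G$ has property $(OB)$ if for every continuous action of $G$ by isometries on a metric space all orbits are bounded. *)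

(* Defs.v *)
From HB Require Import structures.
From mathcomp Require Import all_boot all_order all_algebra.
From mathcomp Require Import complex lra.
From mathcomp Require Import all_classical all_reals all_analysis.
From mathcomp Require Import measurable_realfun sesquilinear generic_quotient.

(* The real line is an arbitrary [R : realType] and the complex numbers are
   [R[i]], whose norm takes its values in [R[i]] and is ordered by the partial
   order of [R[i]] (z <= w iff w - z is a nonnegative real). *)

Set Implicit Arguments.
Unset Strict Implicit.
Unset Printing Implicit Defensive.

Import Order.TTheory GRing.Theory Num.Theory.
Import numFieldNormedType.Exports.

Local Open Scope classical_set_scope.
Local Open Scope ring_scope.

Definition separable_space (T : topologicalType) : Prop :=
  exists2 D : set T, countable D & dense D.

Definition complete_metric (R : realType) (M : metricType R) : Prop :=
  forall u : nat -> M, cauchy (u @ \oo) -> exists l : M, u @ \oo --> l.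

Definition polish_space (R : realType) (T : topologicalType) : Prop :=
  exists (M : metricType R) (h : T -> M) (k : M -> T),
    [/\ cancel h k, cancel k h, continuous h & continuous k] /\
    complete_metric M /\ separable_space M.

Definition standard_borel (R : realType) d (X : measurableType d) : Prop :=
  exists (P : topologicalType) (h : X -> P),
    [/\ polish_space R P, bijective h &
        forall A : set X,
          measurable A <-> exists2 B, <<s @open P >> B & A = h @^-1` B].

Definition diffuse (R : realType) d (X : measurableType d)
    (mu : probability X R) : Prop :=
  forall x : X, mu [set x] = 0%E.

HB.mixin Record isTopologicalGroup G & Topological G & Group G := {
  mulg_continuous : continuous (fun x : G * G => (x.1 * x.2)%g) ;
  invg_continuous : continuous (fun x : G => (x^-1)%g)
}.

#[short(type="topologicalGroupType")]
HB.structure Definition TopologicalGroup :=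
  {G of Topological G & Group G & isTopologicalGroup G}.

(* [{dot H for conjc}]: positive definite, Hermitian, linear in the first
   argument and conjugate-linear in the second. *)
HB.mixin Record CompleteNormedModule_isHilbert (R : realType) H
    & CompleteNormedModule R[i] H := {
  hdot : {dot H for @conjc R} ;
  hdot_normE : forall x : H, `|x| ^+ 2 = hdot x x
}.

#[short(type="hilbertType")]
HB.structure Definition Hilbert (R : realType) :=
  {H of CompleteNormedModule R[i] H & CompleteNormedModule_isHilbert R H}.

Section unitary_representations.
Context (R : realType) (G : topologicalGroupType).

(* Each [pi g] is invertible, with inverse [pi g^-1], so a linear map
   preserving the inner product is unitary here. *)
Definition unitary_representation (H : hilbertType R) (pi : G -> H -> H) :
    Prop :=
  [/\ forall g, linear (pi g),
      forall g x y, hdot (pi g x) (pi g y) = hdot x y,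
      forall x, pi 1%g x = x &
      forall g h x, pi (g * h)%g x = pi g (pi h x)].

Definition strongly_continuous (H : hilbertType R) (pi : G -> H -> H) : Prop :=
  forall x : H, continuous (fun g => pi g x).

Definition almost_invariant_vectors (H : hilbertType R) (pi : G -> H -> H) :
    Prop :=
  forall (e : R) (K : set G), 0 < e -> compact K ->
    exists x : H, `|x| = 1 /\ forall g, K g -> `|x - pi g x| < e%:C%C.

Definition invariant_unit_vector (H : hilbertType R) (pi : G -> H -> H) :
    Prop :=
  exists x : H, `|x| = 1 /\ forall g, pi g x = x.

Definition property_T : Prop :=
  forall (H : hilbertType R) (pi : G -> H -> H),
    unitary_representation pi -> strongly_continuous pi ->
    almost_invariant_vectors pi -> invariant_unit_vector pi.

Definition isometric_action (M : metricType R) (a : G -> M -> M) : Prop :=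
  [/\ forall x, a 1%g x = x,
      forall g h x, a (g * h)%g x = a g (a h x) &
      forall g x y, mdist (a g x) (a g y) = mdist x y].

Definition property_OB : Prop :=
  forall (M : metricType R) (a : G -> M -> M),
    isometric_action a -> continuous (fun p : G * M => a p.1 p.2) ->
    forall x : M, exists C : R, forall g h, mdist (a g x) (a h x) <= C.

End unitary_representations.
Record circle (R : realType) := Circle {
  circle_val :> R[i] ;
  circle_valP : `|circle_val| == 1
}.

HB.instance Definition _ (R : realType) := [isSub for @circle_val R].
HB.instance Definition _ (R : realType) := [Choice of circle R by <:].

Section circle_group.
Context {R : realType}.
Implicit Types z w : circle R.

Lemma norm_circle z : `|circle_val z| = 1.
Proof. exact/eqP/circle_valP. Qed.

Lemma circle_neq0 z : circle_val z != 0.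
Proof. by rewrite -normr_eq0 norm_circle oner_neq0. Qed.

Definition circle_one : circle R := @Circle R 1 (introT eqP (normr1 _)).

Fact circle_mul_subproof z w : `|circle_val z * circle_val w| == 1.
Proof. by rewrite normrM !norm_circle mulr1. Qed.
Definition circle_mul z w : circle R := Circle (circle_mul_subproof z w).

Fact circle_inv_subproof z : `|(circle_val z)^-1| == 1.
Proof. by rewrite normfV norm_circle invr1. Qed.
Definition circle_inv z : circle R := Circle (circle_inv_subproof z).

Fact circle_mulA : associative circle_mul.
Proof. by move=> x y z; apply: val_inj; rewrite /= mulrA. Qed.
Fact circle_mul1 : left_id circle_one circle_mul.
Proof. by move=> x; apply: val_inj; rewrite /= mul1r. Qed.
Fact circle_mulr1 : right_id circle_one circle_mul.
Proof. by move=> x; apply: val_inj; rewrite /= mulr1. Qed.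
Fact circle_mulV : left_inverse circle_one circle_inv circle_mul.
Proof. by move=> x; apply: val_inj; rewrite /= mulVf ?circle_neq0. Qed.
Fact circle_mulrV : right_inverse circle_one circle_inv circle_mul.
Proof. by move=> x; apply: val_inj; rewrite /= mulfV ?circle_neq0. Qed.

HB.instance Definition _ := isGroup.Build (circle R)
  circle_mulA circle_mul1 circle_mulr1 circle_mulV circle_mulrV.

Lemma circle_valM z w : (z * w)%g = circle_val z * circle_val w :> R[i].
Proof. by []. Qed.

Lemma circle_valV z : (z^-1)%g = (circle_val z)^-1 :> R[i].
Proof. by []. Qed.

End circle_group.

Section circle_metric.
Context {R : realType}.
Implicit Types z w : circle R.

Definition circle_dist z w : R := Normc.normc (circle_val z - circle_val w).

Lemma normc_ge0 (a : R[i]) : 0 <= Normc.normc a.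
Proof. by case: a => a b /=; exact: sqrtr_ge0. Qed.

Lemma normcE (a : R[i]) : (Normc.normc a)%:C%C = `|a|.
Proof. by []. Qed.

Lemma circle_distE z w : (circle_dist z w)%:C%C = `|circle_val z - circle_val w|.
Proof. by []. Qed.

Fact circle_distxx z : circle_dist z z = 0.
Proof. by apply: complexI; rewrite circle_distE subrr normr0. Qed.

Fact circle_dist_eq0 z w : circle_dist z w = 0 -> z = w.
Proof.
by move=> /Normc.eq0_normc/eqP; rewrite subr_eq0 => /eqP zw; exact: val_inj.
Qed.

Fact circle_distC z w : circle_dist z w = circle_dist w z.
Proof. by apply: complexI; rewrite !circle_distE distrC. Qed.

Fact circle_dist_triangle w z t :
  circle_dist z t <= circle_dist z w + circle_dist w t.
Proof.
by rewrite -lecR rmorphD/= !circle_distE ler_distD.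
Qed.

HB.instance Definition _ := isMetric.Build R (circle R)
  circle_distxx circle_dist_eq0 circle_distC circle_dist_triangle.
HB.instance Definition _ := isPointed.Build (circle R) 1%g.

(* Borel sigma-algebra of the metric topology. *)
HB.instance Definition _ := @isMeasurable.Build
  (sigma_display (@open (circle R))) (circle R) <<s @open (circle R) >>
  (@sigma_algebra0 _ setT _) (@sigma_algebraC _ _)
  (@sigma_algebra_bigcup _ setT _).

Lemma mdist_circleE z w : mdist z w = Normc.normc (circle_val z - circle_val w).
Proof. by []. Qed.

Lemma mdist_circleM z w z' w' :
  mdist (z * w)%g (z' * w')%g <= mdist z z' + mdist w w'.
Proof.
rewrite !mdist_circleE -lecR rmorphD/= !normcE.
have -> : circle_val (z * w)%g - circle_val (z' * w')%g =
    (circle_val z - circle_val z') * circle_val w +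
    circle_val z' * (circle_val w - circle_val w').
  by rewrite mulrBl mulrBr addrA subrK.
by rewrite (le_trans (ler_normD _ _))// !normrM !norm_circle mulr1 mul1r.
Qed.

Lemma mdist_circleV z w : mdist (z^-1)%g (w^-1)%g = mdist z w.
Proof.
apply: complexI; rewrite !mdist_circleE !normcE.
have -> : circle_val (z^-1)%g - circle_val (w^-1)%g =
    - ((circle_val z)^-1 * (circle_val w)^-1) * (circle_val z - circle_val w).
  rewrite !circle_valV mulrBr !mulNr mulrAC mulVf ?circle_neq0// mul1r.
  by rewrite -mulrA mulVf ?circle_neq0// mulr1 opprK addrC.
by rewrite normrM normrN normrM !normfV !norm_circle invr1 !mul1r.
Qed.

Lemma normc_sqr (a : R[i]) : Normc.normc a ^+ 2 = complex.Re a ^+ 2 + complex.Im a ^+ 2.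
Proof. by case: a => a b /=; rewrite sqr_sqrtr// addr_ge0// sqr_ge0. Qed.

Lemma Re_le_normc (a : R[i]) : `|complex.Re a| <= Normc.normc a.
Proof.
rewrite -(@ler_pXn2r _ 2)// ?nnegrE ?normc_ge0// normc_sqr real_normK ?num_real//.
by rewrite lerDl sqr_ge0.
Qed.

Lemma Im_le_normc (a : R[i]) : `|complex.Im a| <= Normc.normc a.
Proof.
rewrite -(@ler_pXn2r _ 2)// ?nnegrE ?normc_ge0// normc_sqr real_normK ?num_real//.
by rewrite lerDr sqr_ge0.
Qed.

Lemma normc_le_ReIm (a : R[i]) : Normc.normc a <= `|complex.Re a| + `|complex.Im a|.
Proof.
rewrite -(@ler_pXn2r _ 2)// ?nnegrE ?normc_ge0 ?addr_ge0// normc_sqr sqrrD.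
rewrite !real_normK ?num_real// -addrA [X in _ <= _ + X]addrC addrA lerDl.
by rewrite mulrn_wge0// mulr_ge0.
Qed.

Let box (q : rat * rat * rat) : set (circle R) := [set z |
  `|complex.Re (circle_val z) - ratr q.1.1| < ratr q.2 /\
  `|complex.Im (circle_val z) - ratr q.1.2| < ratr q.2].

Let open_bigcup_box (U : set (circle R)) : open U ->
  U = \bigcup_(q in [set q | box q `<=` U]) box q.
Proof.
move=> oU; apply/seteqP; split => [z Uz|z [q /= qU qz]]; last exact: qU.
have /nbhs_ballP[e /= e0 eU] : nbhs z U by move: oU; rewrite openE => /(_ z Uz).
have [r] := @rat_in_itvoo R 0 (e / 4) (divr_gt0 e0 (ltr0Sn _ 3)).
rewrite in_itv/= => /andP[r0 re].
have near_rat (x : R) : exists a : rat, `|x - ratr a| < ratr r.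
  have [|a] := @rat_in_itvoo R (x - ratr r) (x + ratr r).
    by rewrite ltrBlDr -addrA ltrDl addr_gt0.
  by rewrite in_itv/= -ltr_distlC => ?; exists a.
have [a za] := near_rat (complex.Re (circle_val z)).
have [b zb] := near_rat (complex.Im (circle_val z)).
exists (a, b, r) => //= w [/= wa wb]; apply: eU; rewrite ballEmdist/=.
rewrite mdist_circleE (le_lt_trans (normc_le_ReIm _))// !raddfB/=.
rewrite (@le_lt_trans _ _ (ratr r + ratr r + (ratr r + ratr r)))//; last first.
  by lra.
rewrite lerD// ltW//.
  by rewrite (le_lt_trans (ler_distD (ratr a) _ _))// ltrD// distrC.
by rewrite (le_lt_trans (ler_distD (ratr b) _ _))// ltrD// distrC.
Qed.

Lemma measurable_fun_circleP d (X : measurableType d) (f : X -> circle R) :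
  measurable_fun setT f <->
  measurable_fun setT (fun x => complex.Re (circle_val (f x))) /\
  measurable_fun setT (fun x => complex.Im (circle_val (f x))).
Proof.
have open_measurable (U : set (circle R)) : open U -> measurable U.
  by move=> oU; exact: sub_sigma_algebra.
split=> [mf|[mRe mIm]].
  have openRI (p : R[i] -> R) (a : R) :
      (forall u v, p u - p v = p (u - v)) -> (forall u, `|p u| <= Normc.normc u) ->
      open [set z : circle R | p (circle_val z) > a].
    move=> pB ple; rewrite openE => z /= az; apply/nbhs_ballP.
    exists (p (circle_val z) - a) => /=; first by rewrite subr_gt0.
    move=> w; rewrite ballEmdist/= mdist_circleE => zw.
    have : p (circle_val z) - p (circle_val w) < p (circle_val z) - a.
      by rewrite pB (le_lt_trans (ler_norm _))// (le_lt_trans (ple _)).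
    by rewrite ltrD2l ltrN2.
  have mp (p : R[i] -> R) : (forall u v, p u - p v = p (u - v)) ->
      (forall u, `|p u| <= Normc.normc u) ->
      measurable_fun setT (fun x => p (f x)).
    move=> pB ple; apply: (measurability _ (RGenOInfty.measurableE R)).
    move=> _ [_ [a ->] <-]; rewrite setTI.
    rewrite (_ : _ @^-1` _ = f @^-1` [set z | p (circle_val z) > a]).
      rewrite -[X in measurable X]setTI; apply: mf => //.
      by apply: open_measurable; apply: openRI.
    by apply/seteqP; split => x /=; rewrite in_itv/= andbT.
  split; apply: mp.
  - by move=> u v; rewrite raddfB.
  - exact: Re_le_normc.
  - by move=> u v; rewrite raddfB.
  - exact: Im_le_normc.
apply: (measurability (@open (circle R))) => // _ [U oU <-]; rewrite setTI.
rewrite (open_bigcup_box oU) preimage_bigcup bigcup_mkcond.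
apply: countable_bigcupT_measurable => // q; case: ifPn => // _.
have mdlt (g : X -> R) (c e : R) : measurable_fun setT g ->
    measurable [set x | `|g x - c| < e].
  move=> mg; rewrite (_ : [set x | _] = g @^-1` `]c - e, c + e[).
    by rewrite -[X in measurable X]setTI; exact: mg.
  by apply/seteqP; split => x /=; rewrite in_itv/= -ltr_distlC distrC.
rewrite (_ : _ @^-1` _ =
  [set x | `|complex.Re (circle_val (f x)) - ratr q.1.1| < ratr q.2] `&`
  [set x | `|complex.Im (circle_val (f x)) - ratr q.1.2| < ratr q.2])//.
by apply: measurableI; exact: mdlt.
Qed.

End circle_metric.

Section mfun_circle.
Context d (X : measurableType d) (R : realType).
Implicit Types f g : {mfun X >-> circle R}.

Fact measurable_circle_mul f g : measurable_fun setT (fun x => f x * g x)%g.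
Proof.
have [fr fi] := (measurable_fun_circleP _).1 (@measurable_funPT _ _ _ _ f).
have [gr gi] := (measurable_fun_circleP _).1 (@measurable_funPT _ _ _ _ g).
have ReM (u v : R[i]) :
  complex.Re (u * v) = complex.Re u * complex.Re v - complex.Im u * complex.Im v.
  by case: u v => [a b] [c e].
have ImM (u v : R[i]) :
  complex.Im (u * v) = complex.Re u * complex.Im v + complex.Im u * complex.Re v.
  by case: u v => [a b] [c e].
apply/measurable_fun_circleP; split.
  under eq_fun do rewrite circle_valM ReM.
  by apply: measurable_funB; exact: measurable_funM.
under eq_fun do rewrite circle_valM ImM.
by apply: measurable_funD; exact: measurable_funM.
Qed.

Fact measurable_circle_inv f : measurable_fun setT (fun x => (f x)^-1)%g.
Proof.
have [fr fi] := (measurable_fun_circleP _).1 (@measurable_funPT _ _ _ _ f).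
have conjV (u : R[i]) : `|u| = 1 -> u^-1 = conjc u.
  move=> u1; have u0 : u != 0 by rewrite -normr_eq0 u1 oner_neq0.
  apply: (mulfI u0); rewrite mulfV//.
  apply/esym; case: u u1 {u0} => a b [/= /(congr1 (fun x => x ^+ 2))].
  rewrite expr1n sqr_sqrtr ?addr_ge0 ?sqr_ge0// => ab1.
  by apply/eqP; rewrite eq_complex/=; apply/andP; split; apply/eqP; lra.
apply/measurable_fun_circleP; split.
  rewrite (_ : (fun _ => _) = fun x => complex.Re (circle_val (f x)))//.
  apply/funext => x; rewrite circle_valV conjV ?norm_circle//.
  by case: (circle_val (f x)).
rewrite (_ : (fun _ => _) = fun x => - complex.Im (circle_val (f x))).
  exact: measurableT_comp.
apply/funext => x; rewrite circle_valV conjV ?norm_circle//.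
by case: (circle_val (f x)).
Qed.

Definition mfun_circle_mul f g : {mfun X >-> circle R} :=
  HB.pack (fun x => f x * g x)%g
    (isMeasurableFun.Build _ _ _ _ _ (measurable_circle_mul f g)).

Definition mfun_circle_inv f : {mfun X >-> circle R} :=
  HB.pack (fun x => (f x)^-1)%g
    (isMeasurableFun.Build _ _ _ _ _ (measurable_circle_inv f)).

Definition mfun_circle_one : {mfun X >-> circle R} :=
  HB.pack (fun _ : X => 1%g : circle R)
    (isMeasurableFun.Build _ _ _ _ _ (@measurable_cst _ _ _ _ setT (1%g : circle R))).

Lemma measurable_circle_mdist f g :
  measurable_fun setT (fun x => mdist (f x) (g x)).
Proof.
have [fr fi] := (measurable_fun_circleP _).1 (@measurable_funPT _ _ _ _ f).
have [gr gi] := (measurable_fun_circleP _).1 (@measurable_funPT _ _ _ _ g).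
under eq_fun do rewrite mdist_circleE.
rewrite (_ : (fun _ => _) = Num.sqrt \o (fun x =>
  (complex.Re (circle_val (f x)) - complex.Re (circle_val (g x))) ^+ 2 +
  (complex.Im (circle_val (f x)) - complex.Im (circle_val (g x))) ^+ 2)).
  apply: measurableT_comp.
    by apply: continuous_measurable_fun; exact: sqrt_continuous.
  by apply: measurable_funD; apply: measurable_funX; exact: measurable_funB.
by apply/funext => x /=; case: (circle_val (f x)) => a b; case: (circle_val (g x)).
Qed.

Lemma measurable_circle_mdist_ge f g (e : R) :
  measurable [set x | e <= mdist (f x) (g x)].
Proof.
rewrite (_ : [set x | _] = (fun x => mdist (f x) (g x)) @^-1` `[e, +oo[).
  by rewrite -[X in measurable X]setTI; exact: measurable_circle_mdist.
by apply/seteqP; split => x /=; rewrite in_itv/= andbT.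
Qed.

End mfun_circle.

Section L0.
Context d (X : measurableType d) (R : realType) (mu : probability X R).

Definition L0_circle : Type := {mfun_ mu, X >-> circle R}.

HB.instance Definition _ := Choice.on L0_circle.
HB.instance Definition _ := EqQuotient.on L0_circle.

Implicit Types f g h : L0_circle.

Definition L0_class (f : {mfun X >-> circle R}) : L0_circle := (\pi f)%qT.

Lemma L0_classP (f : {mfun X >-> circle R}) : repr (L0_class f) = f %[ae mu].
Proof. by have /eqmodP/asboolP := reprK (L0_class f). Qed.

Lemma L0_eqP f g : (\forall x \ae mu, repr f x = repr g x) -> f = g.
Proof.
move=> fg; rewrite -[f]reprK -[g]reprK; apply/eqmodP/asboolP.
by apply: filterS fg => x.
Qed.

Definition L0_mul f g := L0_class (mfun_circle_mul (repr f) (repr g)).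
Definition L0_inv f := L0_class (mfun_circle_inv (repr f)).
Definition L0_one := L0_class (mfun_circle_one X R).

Lemma L0_mulE f g : \forall x \ae mu, repr (L0_mul f g) x = (repr f x * repr g x)%g.
Proof. by apply: filterS (L0_classP (mfun_circle_mul (repr f) (repr g))) => x; exact. Qed.

Lemma L0_invE f : \forall x \ae mu, repr (L0_inv f) x = ((repr f x)^-1)%g.
Proof. by apply: filterS (L0_classP (mfun_circle_inv (repr f))) => x; exact. Qed.

Lemma L0_oneE : \forall x \ae mu, repr L0_one x = 1%g.
Proof. by apply: filterS (L0_classP (mfun_circle_one X R)) => x; exact. Qed.

Fact L0_mulA : associative L0_mul.
Proof.
move=> f g h; apply: L0_eqP.
have fg : \forall x \ae mu,
    repr (L0_mul (L0_mul f g) h) x = (repr f x * repr g x * repr h x)%g.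
  have := L0_mulE (L0_mul f g) h; have := L0_mulE f g.
  by apply: filterS2 => x -> ->.
have := L0_mulE f (L0_mul g h); have := L0_mulE g h; move: fg.
by apply: filterS3 => x -> -> ->; rewrite mulgA.
Qed.

Fact L0_mul1 : left_id L0_one L0_mul.
Proof.
move=> f; apply: L0_eqP; have := L0_oneE; have := L0_mulE L0_one f.
by apply: filterS2 => x -> ->; rewrite mul1g.
Qed.

Fact L0_mulr1 : right_id L0_one L0_mul.
Proof.
move=> f; apply: L0_eqP; have := L0_oneE; have := L0_mulE f L0_one.
by apply: filterS2 => x -> ->; rewrite mulg1.
Qed.

Fact L0_mulV : left_inverse L0_one L0_inv L0_mul.
Proof.
move=> f; apply: L0_eqP; have := L0_oneE; have := L0_invE f.
have := L0_mulE (L0_inv f) f.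
by apply: filterS3 => x -> -> ->; rewrite mulVg.
Qed.

Fact L0_mulrV : right_inverse L0_one L0_inv L0_mul.
Proof.
move=> f; apply: L0_eqP; have := L0_oneE; have := L0_invE f.
have := L0_mulE f (L0_inv f).
by apply: filterS3 => x -> -> ->; rewrite mulgV.
Qed.

HB.instance Definition _ := isGroup.Build L0_circle
  L0_mulA L0_mul1 L0_mulr1 L0_mulV L0_mulrV.

(* Basic entourages of convergence in measure. Taking the same bound for the
   distance and for the measure of the exceptional set loses no generality:
   [L0_ball f (min e e') `<=` {g | mu {|f - g| >= e} < e'}]. *)
Definition L0_ball f (e : R) : set L0_circle :=
  [set g : L0_circle | (mu [set x | (e <= mdist (repr f x) (repr g x))%R] < e%:E)%E].

Let mu_mono (A B : set X) : measurable A -> measurable B -> A `<=` B ->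
  (mu A <= mu B)%E.
Proof. by move=> mA mB AB; rewrite le_measure ?inE. Qed.

Let mu_ae_mono (A B : set X) : measurable A -> measurable B ->
  (\forall x \ae mu, A x -> B x) -> (mu A <= mu B)%E.
Proof.
move=> mA mB AB.
have N0 : mu (A `\` B) = 0%E.
  apply: measure_negligible; first exact: measurableD.
  by apply: negligibleS AB => x [Ax Bx] /= /(_ Ax).
rewrite (@le_trans _ _ (mu (B `|` (A `\` B))))//.
  apply: mu_mono => //; first by apply: measurableU => //; exact: measurableD.
  by move=> x Ax; have [|] := pselect (B x); [left|right].
by rewrite -[leRHS]adde0 -N0; apply: measureU2 => //; exact: measurableD.
Qed.

Let measurable_dist f g (e : R) :
  measurable [set x | e <= mdist (repr f x) (repr g x)].
Proof. exact: measurable_circle_mdist_ge. Qed.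

Lemma L0_ball_gt0 f g e : L0_ball f e g -> 0 < e.
Proof. by rewrite /L0_ball/= -lte_fin; exact: le_lt_trans. Qed.

Lemma L0_ballS f g e e' : e <= e' -> L0_ball f e g -> L0_ball f e' g.
Proof.
move=> ee' fg; apply: (@le_lt_trans _ _ (mu [set x | e <= mdist (repr f x) (repr g x)])).
  by apply: mu_mono => // x /=; exact: le_trans.
by apply: lt_le_trans fg _; rewrite lee_fin.
Qed.

Fact L0_ball_center f e : 0 < e -> L0_ball f e f.
Proof.
move=> e0; rewrite /L0_ball/= (_ : [set x | _] = set0) ?measure0 ?lte_fin//.
by apply/seteqP; split => x //=; rewrite mdistxx leNgt e0.
Qed.

Fact L0_ball_sym f g e : L0_ball f e g -> L0_ball g e f.
Proof. by rewrite /L0_ball/=; under eq_set do rewrite metric_sym. Qed.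

Fact L0_ball_triangle f g h e1 e2 :
  L0_ball f e1 g -> L0_ball g e2 h -> L0_ball f (e1 + e2) h.
Proof.
rewrite /L0_ball/= => fg gh; rewrite EFinD.
apply: le_lt_trans (lteD fg gh).
apply: le_trans (measureU2 _ _ _) => //.
apply: mu_mono => //; first exact: measurableU.
move=> x /= efh; have [|fe] := leP e1 (mdist (repr f x) (repr g x)); first by left.
right; rewrite leNgt; apply/negP => ge.
have := le_trans efh (metric_triangle _ (repr g x) _).
by rewrite leNgt ltrD.
Qed.

HB.instance Definition _ := hasNbhs.Build L0_circle (nbhs_ (entourage_ L0_ball)).
HB.instance Definition _ := @Nbhs_isPseudoMetric.Build R L0_circle
  (entourage_ L0_ball) erefl L0_ball L0_ball_center L0_ball_sym L0_ball_triangle erefl.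

Fact L0_mul_continuous : continuous (fun x : L0_circle * L0_circle => (x.1 * x.2)%g).
Proof.
move=> [f g]; apply/cvg_ballP => e e0.
have e20 : 0 < e / 2 by rewrite divr_gt0.
exists (ball f (e / 2), ball g (e / 2)).
  by split => /=; exact: nbhsx_ballx.
move=> [f' g'] /= [ff' gg']; rewrite [e]splitr.
apply: le_lt_trans (lteD ff' gg').
apply: le_trans (measureU2 _ _ _) => //.
apply: mu_ae_mono => //; first exact: measurableU.
have := L0_mulE f g; have := L0_mulE f' g'.
apply: filterS2 => x /= -> ->; rewrite -splitr => efg.
have [|fe] := leP (e / 2) (mdist (repr f x) (repr f' x)); first by left.
right; rewrite leNgt; apply/negP => ge.
have := le_trans efg (mdist_circleM _ _ _ _).
by rewrite leNgt [e]splitr ltrD.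
Qed.

Fact L0_inv_continuous : continuous (fun x : L0_circle => (x^-1)%g).
Proof.
move=> f; apply: (@cvg_ballP _ _ _ _ (nbhs_filter f) _ _).2 => e e0.
apply/nbhs_ballP; exists e => //= g fg.
apply: le_lt_trans fg; apply: mu_ae_mono => //.
have := L0_invE f; have := L0_invE g.
by apply: filterS2 => x /= -> ->; rewrite mdist_circleV.
Qed.

HB.instance Definition _ := isTopologicalGroup.Build L0_circle
  L0_mul_continuous L0_inv_continuous.

Lemma cvg_in_measureP (u : nat -> L0_circle) f :
  u @ \oo --> f <->
  forall e : R, 0 < e ->
    mu [set x | e <= mdist (repr (u n) x) (repr f x)] @[n --> \oo] --> 0%E.
Proof.
have fin (g h : L0_circle) e :
    mu [set x | e <= mdist (repr g x) (repr h x)] \is a fin_num.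
  exact: fin_num_measure.
split=> [uf e e0|uf].
  apply/fine_cvgP; split; first by apply: nearW => n; exact: fin.
  apply/cvgrPdist_lt => a a0; near=> n.
  have : L0_ball (u n) (Num.min e a) f.
    apply: L0_ball_sym; near: n.
    by move/cvg_ballP : uf; apply; rewrite lt_min e0.
  rewrite sub0r normrN ger0_norm ?fine_ge0// => uf'.
  rewrite -lte_fin fineK ?fin//.
  rewrite (@lt_le_trans _ _ (Num.min e a)%:E)// ?lee_fin ?ge_min ?lexx ?orbT//.
  apply: le_lt_trans uf'; apply: mu_mono => // x /=.
  by apply: le_trans; rewrite ge_min lexx.
apply/cvg_ballP => e e0.
have /fine_cvgP[_ /cvgrPdist_lt/(_ e e0)] := uf _ e0.
apply: filterS => n; rewrite sub0r normrN ger0_norm ?fine_ge0// => une.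
by apply: L0_ball_sym; rewrite /L0_ball/= -(fineK (fin _ _ _)) lte_fin.
Unshelve. all: by end_near. Qed.

End L0.

(* Main.v *)
(* A countable family of measurable sets generates the sigma-algebra and separates
   points; the first n of them cut X into finitely many atoms, and the functions
   constant on the atoms for some n are dense in L0. Since mu is diffuse, the
   masses of the atoms tend uniformly to 0.

   (OB): if the orbit map at x moves x by less than 1 on a ball of radius e around
   the unit, cut X into N atoms of mass less than e. Any f is the product of its N
   restrictions to the atoms, each of which lies in the ball, so f moves x by at
   most N.

   Not (T): let L0 act on L2(X x X) by (f.xi)(x, y) = f(x) conj(f(y)) xi(x, y). An
   invariant vector vanishes off the diagonal, which is null. The unit vectors with
   density 1/mu(A) for |xi|^2 on A x A, for each atom A of generation n, are fixed
   by the functions constant on these atoms, and a compact set lies within any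
   given distance of such functions for n large.

   Polishness is witnessed by the Ky Fan metric. *)

From HB Require Import structures.
From mathcomp Require Import all_boot all_order all_algebra.
From mathcomp Require Import complex lra ring.
From mathcomp Require Import all_classical all_reals all_analysis.
From mathcomp Require Import measurable_realfun sesquilinear generic_quotient.
Require Import Defs.

Set Implicit Arguments.
Unset Strict Implicit.
Unset Printing Implicit Defensive.

Import Order.TTheory GRing.Theory Num.Theory.
Import numFieldNormedType.Exports.

Local Open Scope classical_set_scope.
Local Open Scope ring_scope.

(** * Almost everywhere convergence of fast sequences *)

(** Both factors of the multiplier matter. If f acted on L2(X) by plain multiplication, the constant
    -1 would move every unit vector by 2; the factor conj(f(y)) cancels constants, and near the
    diagonal it almost cancels every function that is nearly constant on small atoms. The density
    1/mu(A) is forced by the topology. Approximation in measure leaves an exceptional set S without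
    any control, and a vector carried by one atom could live entirely over S. With these weights
    |xi|^2 has marginal mu in each coordinate, so at most 2 mu(S) of its mass has a coordinate in S,
    whatever the generation n. As n grows the mass drifts to the diagonal, and no invariant vector
    survives there because diffuseness makes the diagonal null. In (OB) a function that differs from
    1 only on a small atom is close to 1 whatever its values are, so the number of factors depends
    on the action and on x but not on f. L2 and L0 are both shown complete by passing to fast
    sequences, which converge almost everywhere by Borel-Cantelli. *)

Lemma geometric_increments_cvg (R : realType) (u : nat -> R) :
  (forall k, `|u k.+1 - u k| <= 2^-1 ^+ k) -> cvgn u.
Proof.
move=> uk.
have uE : u = (fun n => u 0%N + series (telescope u) n).
  by apply/funext => n; rewrite -eq_sum_telescope.
rewrite uE; apply: is_cvgD; first exact: is_cvg_cst.
have cg : cvgn (series (geometric 1 (2^-1 : R))).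
  by apply: is_cvg_geometric_series; rewrite ger0_norm//; lra.
apply: normed_cvg; apply: series_le_cvg cg => n /=.
- exact: normr_ge0.
- by rewrite mul1r exprn_ge0.
- by rewrite mul1r; exact: uk.
Qed.

Section fast_convergence.
Context d (T : measurableType d) (R : realType) (mu : {measure set T -> \bar R}).

(** Borel-Cantelli: the masses have sum at most 2. *)
Lemma geometric_measure_lim_sup0 (E : nat -> set T) :
  (forall k, measurable (E k)) -> (forall k, mu (E k) <= (2^-1 ^+ k)%:E)%E ->
  mu (lim_sup_set E) = 0%E.
Proof.
move=> mE Ek; apply: lim_sup_set_cvg0 => //.
apply: (@le_lt_trans _ _ 2%:E); last by rewrite ltry.
have := @epsilon_trick0 R 2 xpredT ltac:(lra).
apply: le_trans; apply: lee_nneseries => // k _.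
have -> : 2 / (2 ^ k.+1)%N%:R = 2^-1 ^+ k :> R.
  by rewrite natrX exprS invfM mulrA divff// mul1r exprVn.
exact: Ek.
Qed.

(** Almost every point lies in only finitely many of the sets where consecutive terms are far apart,
    and from then on its increments are geometric. Completeness of L2 and of L0 both rest on
    this. *)
Lemma fast_cvg_ae (u : nat -> T -> R) :
  (forall n, measurable_fun setT (u n)) ->
  (forall k, mu [set x | (2^-1 ^+ k <= `|u k.+1 x - u k x|)%R] <=
     (2^-1 ^+ k)%:E)%E ->
  exists2 F : T -> R, measurable_fun setT F &
    \forall x \ae mu, u ^~ x @ \oo --> F x.
Proof.
move=> mu_ uk; pose E k := [set x | 2^-1 ^+ k <= `|u k.+1 x - u k x|].
have mE k : measurable (E k).
  rewrite (_ : E k = (fun x => `|u k.+1 x - u k x|) @^-1` `[2^-1 ^+ k, +oo[).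
    rewrite -[X in measurable X]setTI; apply: measurableT_comp => //.
    exact: measurable_funB.
  by apply/seteqP; split => x /=; rewrite in_itv/= andbT.
have mL : measurable (lim_sup_set E).
  by apply: bigcap_measurable => // n _; exact: bigcup_measurable.
have L0 := geometric_measure_lim_sup0 mE uk.
have cu x : ~ lim_sup_set E x -> cvgn (u ^~ x).
  move=> /existsNP[n /not_implyP[_ nE]].
  suff /cvg_ex[l ul] : cvgn (fun k => u (k + n)%N x).
    by apply/cvg_ex; exists l; rewrite -(cvg_shiftn n).
  apply: geometric_increments_cvg => k.
  have : ~ E (k + n)%N x.
    by move=> ?; apply: nE; exists (k + n)%N => //=; rewrite leq_addl.
  move=> /negP; rewrite -ltNge => /ltW /le_trans; apply.
  by rewrite exprD ler_piMr ?exprn_ge0// exprn_ile1//; lra.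
(* Cutting [u] off on the null set makes the sequence converge everywhere, as measurability of the
   limit requires. *)
pose v k x := u k x * \1_(~` lim_sup_set E) x.
pose F x := limn (v ^~ x).
have vL x : lim_sup_set E x -> v ^~ x = cst 0.
  by move=> Lx; apply/funext => k; rewrite /v indicE memNset ?mulr0//= => /(_ Lx).
have vN x : ~ lim_sup_set E x -> v ^~ x = u ^~ x.
  by move=> Lx; apply/funext => k; rewrite /v indicE mem_set// mulr1.
exists F.
  apply: (@measurable_fun_cvg _ _ _ _ v) => [k|x _].
    by apply: measurable_funM => //; exact/measurable_indic/measurableC.
  rewrite /F; have [Lx|Lx] := pselect (lim_sup_set E x).
    by rewrite vL//; exact: is_cvg_cst.
  by rewrite vN//; exact: cu.
exists (lim_sup_set E); split => // x /= Fx; apply: contrapT => Lx; apply: Fx.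
by rewrite /F vN//; exact: cu.
Qed.

End fast_convergence.

(** * Complex-valued square integrable functions *)

Section complex_parts.
Context {R : realType}.
Implicit Types z w : R[i].

(** A real polynomial in the two parts, so that integration, measurability and [ring] or [nra] apply
    directly, unlike with the norm valued in [R[i]]. *)
Definition sqnormc z : R := complex.Re z ^+ 2 + complex.Im z ^+ 2.

Lemma complexP z w : complex.Re z = complex.Re w -> complex.Im z = complex.Im w -> z = w.
Proof. by case: z w => [a b] [a' b'] /= -> ->. Qed.

Lemma ReM z w :
  complex.Re (z * w) = complex.Re z * complex.Re w - complex.Im z * complex.Im w.
Proof. by case: z w => [a b] [c e]. Qed.

Lemma ImM z w :
  complex.Im (z * w) = complex.Re z * complex.Im w + complex.Im z * complex.Re w.
Proof. by case: z w => [a b] [c e]. Qed.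

Lemma ReD z w : complex.Re (z + w) = complex.Re z + complex.Re w.
Proof. exact: raddfD. Qed.

Lemma ImD z w : complex.Im (z + w) = complex.Im z + complex.Im w.
Proof. exact: raddfD. Qed.

Lemma ReJ z : complex.Re (conjc z) = complex.Re z. Proof. by case: z. Qed.

Lemma ImJ z : complex.Im (conjc z) = - complex.Im z. Proof. by case: z. Qed.

Definition ReImE := (ReM, ImM, ReD, ImD, ReJ, ImJ).

Lemma sqnormc_ge0 z : 0 <= sqnormc z.
Proof. by rewrite addr_ge0 ?sqr_ge0. Qed.

Lemma sqnormcM z w : sqnormc (z * w) = sqnormc z * sqnormc w.
Proof. by rewrite /sqnormc !ReImE; ring. Qed.

Lemma sqnormcD_le z w : sqnormc (z + w) <= 2 * sqnormc z + 2 * sqnormc w.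
Proof.
rewrite /sqnormc !ReImE.
have := sqr_ge0 (complex.Re z - complex.Re w).
have := sqr_ge0 (complex.Im z - complex.Im w).
nra.
Qed.

Lemma sqnormcN z : sqnormc (- z) = sqnormc z.
Proof. by case: z => a b; rewrite /sqnormc/= !sqrrN. Qed.

Lemma sqnormc_eq0 z : sqnormc z = 0 -> z = 0.
Proof.
move=> /eqP; rewrite paddr_eq0 ?sqr_ge0// !sqrf_eq0 => /andP[/eqP ? /eqP ?].
exact: complexP.
Qed.

Lemma sqnormcE z : sqnormc z = Normc.normc z ^+ 2.
Proof. by rewrite normc_sqr. Qed.

(** Balls of a normed space over [R[i]] have complex radii; this turns a positive one into a real
    number. *)
Lemma complex_gt0 (e : R[i]) : 0 < e -> e = (complex.Re e)%:C%C /\ 0 < complex.Re e.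
Proof. by case: e => a b; rewrite ltcE/= => /andP[/eqP -> ->]. Qed.

End complex_parts.

Lemma cauchy_schwarz_discriminant (R : realType) (a b c : R) : 0 <= a -> 0 <= c ->
  (forall t, 0 <= a + 2 * t * b + t ^+ 2 * c) -> b <= Num.sqrt a * Num.sqrt c.
Proof.
move=> a0 c0 H; have [b0|b0] := leP b 0.
  by rewrite (le_trans b0)// mulr_ge0// sqrtr_ge0.
have [c00|c00] := eqVneq c 0.
  (* With [c = 0] the form is affine in [t], and this [t] gives it the value -1. *)
  have := H (- (a + 1) / (2 * b)); rewrite c00 mulr0 addr0.
  rewrite (_ : 2 * _ * b = - (a + 1)); last by field; rewrite gt_eqF.
  by lra.
have cp : 0 < c by rewrite lt_def c00.
rewrite -sqrtrM// -(ger0_norm (ltW b0)) -sqrtr_sqr ler_wsqrtr//.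
(* The minimiser of the quadratic form. *)
have := H (- b / c).
rewrite (_ : _ + _ + _ = (a * c - b ^+ 2) / c); last by field.
by rewrite pmulr_lge0 ?invr_gt0// subr_ge0.
Qed.

Section L2.
Context d (Y : measurableType d) (R : realType) (nu : {measure set Y -> \bar R}).
Implicit Types f g : Y -> R[i].

Definition measurable_cfun f :=
  measurable_fun setT (fun y => complex.Re (f y)) /\
  measurable_fun setT (fun y => complex.Im (f y)).

Definition square_integrable f :=
  measurable_cfun f /\ nu.-integrable setT (fun y => (sqnormc (f y))%:E).

Lemma measurable_cfunM f g : measurable_cfun f -> measurable_cfun g ->
  measurable_cfun (fun y => f y * g y).
Proof.
move=> [fr fi] [gr gi]; split.
  under eq_fun do rewrite ReM.
  by apply: measurable_funB; exact: measurable_funM.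
under eq_fun do rewrite ImM.
by apply: measurable_funD; exact: measurable_funM.
Qed.

Lemma measurable_cfunD f g : measurable_cfun f -> measurable_cfun g ->
  measurable_cfun (fun y => f y + g y).
Proof.
move=> [fr fi] [gr gi]; split.
  by under eq_fun do rewrite ReD; exact: measurable_funD.
by under eq_fun do rewrite ImD; exact: measurable_funD.
Qed.

Lemma measurable_cfun_conj f : measurable_cfun f ->
  measurable_cfun (fun y => conjc (f y)).
Proof.
move=> [fr fi]; split; first by under eq_fun do rewrite ReJ.
by under eq_fun do rewrite ImJ; exact: measurableT_comp.
Qed.

Lemma measurable_cfun_cst (z : R[i]) : measurable_cfun (fun=> z).
Proof. by split; exact: measurable_cst. Qed.

Lemma measurable_sqnormc f : measurable_cfun f ->
  measurable_fun setT (fun y => sqnormc (f y)).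
Proof.
by move=> [fr fi]; apply: measurable_funD; exact: measurable_funX.
Qed.

Lemma integrable_dominated (h k : Y -> R) : measurable_fun setT h ->
  nu.-integrable setT (fun y => (k y)%:E) -> (forall y, `|h y| <= k y) ->
  nu.-integrable setT (fun y => (h y)%:E).
Proof.
move=> mh ik hk; apply: le_integrable ik => //; first exact/measurable_EFinP.
by move=> y _; rewrite /= lee_fin (le_trans (hk y))// ler_norm.
Qed.

Lemma square_integrableP f (k : Y -> R) : measurable_cfun f ->
  nu.-integrable setT (fun y => (k y)%:E) ->
  (forall y, sqnormc (f y) <= k y) -> square_integrable f.
Proof.
move=> mf ik fk; split=> //; apply: integrable_dominated ik _ => //.
  exact: measurable_sqnormc.
by move=> y; rewrite ger0_norm ?sqnormc_ge0.
Qed.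

Lemma square_integrableD f g : square_integrable f -> square_integrable g ->
  square_integrable (fun y => f y + g y).
Proof.
move=> [mf sf] [mg sg].
apply: (@square_integrableP _ (fun y => 2 * sqnormc (f y) + 2 * sqnormc (g y))).
- exact: measurable_cfunD.
- under eq_fun do rewrite EFinD !EFinM.
  by apply: integrableD => //; exact: integrableZl.
- by move=> y; exact: sqnormcD_le.
Qed.

Lemma square_integrableM (M : R) f g : square_integrable f -> measurable_cfun g ->
  (forall y, sqnormc (g y) <= M) -> square_integrable (fun y => g y * f y).
Proof.
move=> [mf sf] mg gM.
apply: (@square_integrableP _ (fun y => M * sqnormc (f y))).
- exact: measurable_cfunM.
- by under eq_fun do rewrite EFinM; exact: integrableZl.
- by move=> y; rewrite sqnormcM ler_wpM2r// sqnormc_ge0.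
Qed.

Lemma square_integrableZ (a : R[i]) f : square_integrable f ->
  square_integrable (fun y => a * f y).
Proof.
move=> sf; apply: (square_integrableM sf (measurable_cfun_cst a)) => y.
exact: lexx.
Qed.

Lemma square_integrableN f : square_integrable f ->
  square_integrable (fun y => - f y).
Proof.
by move=> /(square_integrableZ (-1)); under eq_fun do rewrite mulN1r.
Qed.

Lemma square_integrable0 : square_integrable (fun=> 0).
Proof.
apply: (@square_integrableP _ (fun=> 0)) => [||y].
- exact: measurable_cfun_cst.
- exact: integrable0.
- by rewrite /sqnormc/= expr0n/= addr0.
Qed.

Lemma square_integrable_ae f g : measurable_cfun g -> (\forall y \ae nu, f y = g y) ->
  square_integrable f -> square_integrable g.
Proof.
move=> mg fg [mf sf]; split=> //.
have mE h : measurable_cfun h -> measurable_fun setT (fun y => (sqnormc (h y))%:E).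
  by move=> ?; exact/measurable_EFinP/measurable_sqnormc.
apply/integrableP; split; first exact: mE.
have /integrableP[_] := sf; congr (_ < _)%E.
apply: ae_eq_integral => //; [|by apply: measurableT_comp => //; exact: mE..|].
  by apply: measurableT_comp => //; exact: mE.
by apply: filterS fg => y -> .
Qed.

Definition cintegrable f :=
  nu.-integrable setT (fun y => (complex.Re (f y))%:E) /\
  nu.-integrable setT (fun y => (complex.Im (f y))%:E).

Definition cintegral f : R[i] :=
  ((\int[nu]_y complex.Re (f y)) +i* (\int[nu]_y complex.Im (f y)))%C.

Lemma cintegralD f g : cintegrable f -> cintegrable g ->
  cintegral (fun y => f y + g y) = cintegral f + cintegral g.
Proof.
move=> [fr fi] [gr gi]; apply: complexP; rewrite ?ReD ?ImD/=.
  by under eq_Rintegral do rewrite ReD; rewrite RintegralD.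
by under eq_Rintegral do rewrite ImD; rewrite RintegralD.
Qed.

Lemma cintegralZ (a : R[i]) f : cintegrable f ->
  cintegral (fun y => a * f y) = a * cintegral f.
Proof.
move=> [fr fi].
have iZ (b : R) (h : Y -> R) : nu.-integrable setT (fun y => (h y)%:E) ->
    nu.-integrable setT (fun y => (b * h y)%:E).
  by move=> ih; under eq_fun do rewrite EFinM; exact: integrableZl.
apply: complexP; rewrite ?ReM ?ImM/=.
  under eq_Rintegral do rewrite ReM.
  by rewrite RintegralB ?RintegralZl//; exact: iZ.
under eq_Rintegral do rewrite ImM.
by rewrite RintegralD ?RintegralZl//; exact: iZ.
Qed.

Lemma cintegral_conj f : cintegrable f ->
  cintegral (fun y => conjc (f y)) = conjc (cintegral f).
Proof.
move=> [fr fi]; apply: complexP; rewrite ?ReJ ?ImJ/=.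
  by under eq_Rintegral do rewrite ReJ.
by under eq_Rintegral do rewrite ImJ -mulN1r; rewrite RintegralZl// mulN1r.
Qed.

Lemma cintegrable_mul_conj f g : square_integrable f -> square_integrable g ->
  cintegrable (fun y => f y * conjc (g y)).
Proof.
move=> [mf sf] [mg sg].
have [mr mi] := measurable_cfunM mf (measurable_cfun_conj mg).
have bound (h : Y -> R) : measurable_fun setT h ->
    (forall y, `|h y| <= sqnormc (f y) + sqnormc (g y)) ->
    nu.-integrable setT (fun y => (h y)%:E).
  move=> mh hfg.
  apply: (@integrable_dominated _ (fun y => sqnormc (f y) + sqnormc (g y))) => //.
  by under eq_fun do rewrite EFinD; exact: integrableD.
(* Each part of f conj(g) is a sum of two products of real parts and imaginary parts; the squares of
   all sums and differences bound these products from both sides. *)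
split; apply: bound => // y; rewrite !ReImE /sqnormc ler_norml;
  set a := complex.Re (f y); set b := complex.Im (f y);
  set a' := complex.Re (g y); set b' := complex.Im (g y);
  have := sqr_ge0 (a + a'); have := sqr_ge0 (a - a');
  have := sqr_ge0 (a + b'); have := sqr_ge0 (a - b');
  have := sqr_ge0 (b + b'); have := sqr_ge0 (b - b');
  have := sqr_ge0 (b + a'); have := sqr_ge0 (b - a');
  move=> ? ? ? ? ? ? ? ?; apply/andP; split; nra.
Qed.

Lemma cintegral_ae f g : measurable_cfun f -> measurable_cfun g ->
  (\forall y \ae nu, f y = g y) -> cintegral f = cintegral g.
Proof.
move=> [fr fi] [gr gi] fg; rewrite /cintegral /Rintegral.
congr (fine _ +i* fine _)%C; apply: ae_eq_integral => //;
  [exact/measurable_EFinP|exact/measurable_EFinP| |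
   exact/measurable_EFinP|exact/measurable_EFinP|]; by apply: filterS fg => y ->.
Qed.

End L2.

(** * The complex Hilbert space L2 *)

Section L2_type.
Context d (Y : measurableType d) (R : realType) (nu : {measure set Y -> \bar R}).
Implicit Types f g : Y -> R[i].

(* Depends on [f] only through its almost everywhere class. *)
Definition canonical_version f : Y -> R[i] :=
  xget (fun=> 0) [set g | measurable_cfun g /\ \forall y \ae nu, f y = g y].

Lemma canonical_versionP f : measurable_cfun f ->
  measurable_cfun (canonical_version f) /\
  \forall y \ae nu, f y = canonical_version f y.
Proof.
move=> mf; rewrite /canonical_version.
case: xgetP => [g _ //|/(_ f)] /=; apply: contra_notP => _; split=> //.
exact: aeW.
Qed.

(** The sets from which [xget] chooses are equal for f and g, so the choices coincide. *)
Lemma canonical_version_ae f g : (\forall y \ae nu, f y = g y) ->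
  canonical_version f = canonical_version g.
Proof.
move=> fg; rewrite /canonical_version; congr (xget _ _).
apply/seteqP; split => h [mh fh]; split=> //; move: fg fh; apply: filterS2 => y.
  by move=> ->.
by move=> <-.
Qed.

(** Keeping only the chosen representatives turns almost everywhere equality into Leibniz equality,
    without a quotient. *)
Definition L2_pred f := `[< square_integrable nu f /\ canonical_version f = f >].

Record L2 := MkL2 { L2_fun :> Y -> R[i] ; L2_funP : L2_pred L2_fun }.

HB.instance Definition _ := [isSub for L2_fun].
HB.instance Definition _ := [Choice of L2 by <:].

Implicit Types x y z : L2.

Lemma square_integrable_canonical f : square_integrable nu f ->
  L2_pred (canonical_version f).
Proof.
move=> sf; have [mc cf] := canonical_versionP sf.1; apply/asboolP; split.
  exact: square_integrable_ae cf sf.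
by apply: canonical_version_ae; apply: filterS cf => y ->.
Qed.

(* Zero when [f] is not square integrable. *)
Definition L2_class f : L2 :=
  if pselect (square_integrable nu f) is left sf
  then MkL2 (square_integrable_canonical sf)
  else MkL2 (square_integrable_canonical (square_integrable0 nu)).

Lemma L2_classE f : square_integrable nu f -> \forall t \ae nu, L2_class f t = f t.
Proof.
move=> sf; rewrite /L2_class; case: pselect => // sf' /=.
by have [_] := canonical_versionP sf'.1; apply: filterS => t ->.
Qed.

Lemma L2_square_integrable x : square_integrable nu x.
Proof. by have /asboolP[] := L2_funP x. Qed.
Hint Resolve L2_square_integrable : core.

Lemma L2_measurable x : measurable_cfun x.
Proof. by case: (L2_square_integrable x). Qed.
Hint Resolve L2_measurable : core.

Lemma L2_ae_eq x y : (\forall t \ae nu, x t = y t) -> x = y.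
Proof.
move=> xy; apply: val_inj; have /asboolP[_ /= <-] := L2_funP x.
by have /asboolP[_ /= <-] := L2_funP y; exact: canonical_version_ae.
Qed.

Definition L2_zero := L2_class (fun=> 0).
Definition L2_add x y := L2_class (fun t => x t + y t).
Definition L2_opp x := L2_class (fun t => - x t).
Definition L2_scale (a : R[i]) x := L2_class (fun t => a * x t).

Lemma L2_zeroE : \forall t \ae nu, L2_zero t = 0.
Proof. exact/L2_classE/square_integrable0. Qed.

Lemma L2_addE x y : \forall t \ae nu, L2_add x y t = x t + y t.
Proof. exact/L2_classE/square_integrableD. Qed.

Lemma L2_oppE x : \forall t \ae nu, L2_opp x t = - x t.
Proof. exact/L2_classE/square_integrableN. Qed.

Lemma L2_scaleE a x : \forall t \ae nu, L2_scale a x t = a * x t.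
Proof. exact/L2_classE/square_integrableZ. Qed.

Fact L2_addA : associative L2_add.
Proof.
move=> x y z; apply: L2_ae_eq; near=> t.
rewrite (near (L2_addE x (L2_add y z)) t)// (near (L2_addE (L2_add x y) z) t)//.
by rewrite (near (L2_addE y z) t)// (near (L2_addE x y) t)// addrA.
Unshelve. all: by end_near. Qed.

Fact L2_addC : commutative L2_add.
Proof.
move=> x y; apply: L2_ae_eq; near=> t.
by rewrite (near (L2_addE x y) t)// (near (L2_addE y x) t)// addrC.
Unshelve. all: by end_near. Qed.

Fact L2_add0 : left_id L2_zero L2_add.
Proof.
move=> x; apply: L2_ae_eq; near=> t.
by rewrite (near (L2_addE L2_zero x) t)// (near L2_zeroE t)// add0r.
Unshelve. all: by end_near. Qed.

Fact L2_addN : left_inverse L2_zero L2_opp L2_add.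
Proof.
move=> x; apply: L2_ae_eq; near=> t.
rewrite (near (L2_addE (L2_opp x) x) t)// (near L2_zeroE t)//.
by rewrite (near (L2_oppE x) t)// addNr.
Unshelve. all: by end_near. Qed.

HB.instance Definition _ := GRing.isZmodule.Build L2
  L2_addA L2_addC L2_add0 L2_addN.

Fact L2_scaleA (a b : R[i]) x : L2_scale a (L2_scale b x) = L2_scale (a * b) x.
Proof.
apply: L2_ae_eq; near=> t.
rewrite (near (L2_scaleE a (L2_scale b x)) t)// (near (L2_scaleE b x) t)//.
by rewrite (near (L2_scaleE (a * b) x) t)// mulrA.
Unshelve. all: by end_near. Qed.

Fact L2_scale1 : left_id 1 L2_scale.
Proof.
move=> x; apply: L2_ae_eq; near=> t.
by rewrite (near (L2_scaleE 1 x) t)// mul1r.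
Unshelve. all: by end_near. Qed.

Fact L2_scaleDr : right_distributive L2_scale +%R.
Proof.
move=> a x y; apply: L2_ae_eq; near=> t.
rewrite (near (L2_scaleE a (L2_add x y)) t)// (near (L2_addE x y) t)//.
rewrite (near (L2_addE (L2_scale a x) (L2_scale a y)) t)//.
by rewrite (near (L2_scaleE a x) t)// (near (L2_scaleE a y) t)// mulrDr.
Unshelve. all: by end_near. Qed.

Fact L2_scaleDl x : {morph L2_scale^~ x : a b / a + b}.
Proof.
move=> a b; apply: L2_ae_eq; near=> t.
rewrite (near (L2_scaleE (a + b) x) t)//.
rewrite (near (L2_addE (L2_scale a x) (L2_scale b x)) t)//.
by rewrite (near (L2_scaleE a x) t)// (near (L2_scaleE b x) t)// mulrDl.
Unshelve. all: by end_near. Qed.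

HB.instance Definition _ := GRing.Zmodule_isLmodule.Build R[i] L2
  L2_scaleA L2_scale1 L2_scaleDr L2_scaleDl.

Definition L2_dot x y : R[i] := cintegral nu (fun t => x t * conjc (y t)).

Lemma L2_dot_class f y : square_integrable nu f ->
  L2_dot (L2_class f) y = cintegral nu (fun t => f t * conjc (y t)).
Proof.
move=> sf; apply: cintegral_ae.
- exact/measurable_cfunM/measurable_cfun_conj.
- by apply: measurable_cfunM; [case: sf|exact: measurable_cfun_conj].
- by apply: filterS (L2_classE sf) => t ->.
Qed.

Lemma L2_dotC x y : L2_dot x y = conjc (L2_dot y x).
Proof.
rewrite /L2_dot -cintegral_conj; last exact: cintegrable_mul_conj.
congr cintegral; apply/funext => t.
by apply: complexP; rewrite !ReImE; ring.
Qed.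

Lemma L2_dotDl x x' y : L2_dot (x + x') y = L2_dot x y + L2_dot x' y.
Proof.
rewrite [LHS]L2_dot_class; last exact: square_integrableD.
rewrite -cintegralD; [|exact: cintegrable_mul_conj..].
by congr cintegral; apply/funext => t; rewrite mulrDl.
Qed.

Lemma L2_dotZl a x y : L2_dot (a *: x) y = a * L2_dot x y.
Proof.
rewrite [LHS]L2_dot_class; last exact: square_integrableZ.
rewrite -cintegralZ; last exact: cintegrable_mul_conj.
by congr cintegral; apply/funext => t; rewrite mulrA.
Qed.

Lemma L2_dotDr x y y' : L2_dot x (y + y') = L2_dot x y + L2_dot x y'.
Proof.
by rewrite L2_dotC L2_dotDl (L2_dotC x y) (L2_dotC x y') rmorphD.
Qed.

Lemma L2_dotZr a x y : L2_dot x (a *: y) = conjc a * L2_dot x y.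
Proof. by rewrite L2_dotC L2_dotZl (L2_dotC x y) rmorphM. Qed.

Definition L2_sqnorm x : R := \int[nu]_t sqnormc (x t).

Lemma L2_sqnorm_ge0 x : 0 <= L2_sqnorm x.
Proof. by apply: Rintegral_ge0 => t _; exact: sqnormc_ge0. Qed.

Lemma L2_sqnormE x : (L2_sqnorm x)%:E = (\int[nu]_t (sqnormc (x t))%:E)%E.
Proof.
rewrite /L2_sqnorm /Rintegral fineK//; apply: integrable_fin_num => //.
by have [] := L2_square_integrable x.
Qed.

Lemma L2_dotxx x : L2_dot x x = (L2_sqnorm x)%:C%C.
Proof.
apply: complexP => /=.
  by apply: eq_Rintegral => t _; rewrite !ReImE /sqnormc; ring.
rewrite (_ : (fun t => _) = cst 0); first by rewrite Rintegral_cst// mul0r.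
by apply/funext => t; rewrite !ReImE/=; ring.
Qed.

Lemma L2_sqnorm_eq0 x : L2_sqnorm x = 0 -> x = 0.
Proof.
move=> x0; apply: L2_ae_eq.
have mx : measurable_fun setT (fun t => (sqnormc (x t))%:E).
  by apply/measurable_EFinP; exact: measurable_sqnormc.
have : (\int[nu]_t `|(sqnormc (x t))%:E| = 0)%E.
  rewrite -[RHS]/(0%:E) -x0 L2_sqnormE; apply: eq_integral => t _.
  by rewrite gee0_abs// lee_fin sqnormc_ge0.
move=> /(ae_eq_integral_abs nu measurableT mx).1; have := L2_zeroE.
by apply: filterS2 => t -> /(_ I) [] /sqnormc_eq0.
Qed.

Lemma L2_sqnormD x y :
  L2_sqnorm (x + y) = L2_sqnorm x + 2 * complex.Re (L2_dot x y) + L2_sqnorm y.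
Proof.
have /(congr1 (@complex.Re R)) := L2_dotxx (x + y).
rewrite L2_dotDl !L2_dotDr [L2_dot y x]L2_dotC !ReD !L2_dotxx ReJ/= => <-.
ring.
Qed.

Lemma L2_sqnormZ a x : L2_sqnorm (a *: x) = sqnormc a * L2_sqnorm x.
Proof.
have /(congr1 (@complex.Re R)) := L2_dotxx (a *: x).
rewrite L2_dotZl L2_dotZr L2_dotxx !ReImE/= => <-; rewrite /sqnormc; ring.
Qed.

Lemma L2_cauchy_schwarz x y :
  complex.Re (L2_dot x y) <= Num.sqrt (L2_sqnorm x) * Num.sqrt (L2_sqnorm y).
Proof.
apply: cauchy_schwarz_discriminant; [exact: L2_sqnorm_ge0..|] => t.
have := L2_sqnorm_ge0 (x + t%:C%C *: y).
rewrite L2_sqnormD L2_sqnormZ L2_dotZr !ReImE/= /sqnormc/=; congr (_ <= _); ring.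
Qed.

Definition L2_norm x : R := Num.sqrt (L2_sqnorm x).

Lemma L2_normD x y : L2_norm (x + y) <= L2_norm x + L2_norm y.
Proof.
have x0 : 0 <= L2_norm x by exact: sqrtr_ge0.
have y0 : 0 <= L2_norm y by exact: sqrtr_ge0.
rewrite -(@ler_pXn2r _ 2)// ?nnegrE ?sqrtr_ge0 ?addr_ge0// sqrrD.
rewrite !sqr_sqrtr ?L2_sqnorm_ge0// L2_sqnormD lerD2r lerD2l mulr2n.
have := L2_cauchy_schwarz x y; rewrite -!/(L2_norm _); lra.
Qed.

(** A normed module over [R[i]] takes its norm in [R[i]]; estimates are made with the real
    [L2_norm]. *)
Definition L2_cnorm x : R[i] := (L2_norm x)%:C%C.

Fact L2_cnormD x y : L2_cnorm (x + y) <= L2_cnorm x + L2_cnorm y.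
Proof. by rewrite /L2_cnorm -rmorphD lecR L2_normD. Qed.

Fact L2_cnormZ a x : L2_cnorm (a *: x) = `|a| * L2_cnorm x.
Proof.
rewrite /L2_cnorm /L2_norm L2_sqnormZ sqrtrM ?sqnormc_ge0// rmorphM.
by rewrite sqnormcE sqrtr_sqr ger0_norm ?normc_ge0.
Qed.

Fact L2_cnorm_eq0 x : L2_cnorm x = 0 -> x = 0.
Proof.
move=> /(congr1 (@complex.Re R))/eqP/=; rewrite sqrtr_eq0 => x0.
by apply/L2_sqnorm_eq0/eqP; rewrite eq_le x0 L2_sqnorm_ge0.
Qed.

HB.instance Definition _ := Lmodule_isNormed.Build R[i] L2
  L2_cnormD L2_cnormZ L2_cnorm_eq0.

Lemma L2_normE x : `|x| = (Num.sqrt (L2_sqnorm x))%:C%C.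
Proof. by []. Qed.

End L2_type.

(** * Inner product and completeness of L2 *)

Section L2_hilbert.
Context d (Y : measurableType d) (R : realType) (nu : {measure set Y -> \bar R}).
Local Notation L2 := (L2 nu).
Implicit Types x y z : L2.

Fact L2_dot_zmod_morphisml y : zmod_morphism (@L2_dot _ _ _ nu ^~ y).
Proof. by move=> x x'; rewrite L2_dotDl -scaleN1r L2_dotZl mulN1r. Qed.

Fact L2_dot_zmod_morphismr x : zmod_morphism (@L2_dot _ _ _ nu x).
Proof.
by move=> y y'; rewrite L2_dotDr -scaleN1r L2_dotZr rmorphN1 mulN1r.
Qed.

Fact L2_dot_scalarl y : scalable_for *%R (@L2_dot _ _ _ nu ^~ y).
Proof. by move=> a x; exact: L2_dotZl. Qed.

Fact L2_dot_scalarr x : scalable_for (@conjc R \; *%R) (@L2_dot _ _ _ nu x).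
Proof. by move=> a y; exact: L2_dotZr. Qed.

HB.instance Definition _ := isBilinear.Build R[i] L2 L2 R[i] *%R (@conjc R \; *%R)
  (@L2_dot _ _ _ nu) L2_dot_zmod_morphisml L2_dot_zmod_morphismr L2_dot_scalarl L2_dot_scalarr.

Fact L2_dot_hermitian x y : L2_dot x y = (-1) ^+ false * conjc (L2_dot y x).
Proof. by rewrite expr0 mul1r L2_dotC. Qed.

HB.instance Definition _ := isHermitianSesquilinear.Build R[i] L2 false (@conjc R)
  (@L2_dot _ _ _ nu) L2_dot_hermitian.

Fact L2_dot_gt0 x : x != 0 -> 0 < L2_dot x x.
Proof.
move=> x0; rewrite L2_dotxx ltcR lt_def L2_sqnorm_ge0 andbT.
by apply: contra_neq x0 => /L2_sqnorm_eq0.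
Qed.

HB.instance Definition _ := isDotProduct.Build R[i] L2 (@L2_dot _ _ _ nu) L2_dot_gt0.

Lemma L2_subE x y : \forall t \ae nu, (x - y) t = x t - y t.
Proof.
near=> t; rewrite (near (L2_addE x (- y)) t)//.
by rewrite (near (L2_oppE y) t).
Unshelve. all: by end_near. Qed.

Lemma square_integrableB f g : square_integrable nu f -> square_integrable nu g ->
  square_integrable nu (fun t => f t - g t).
Proof. by move=> sf sg; apply: square_integrableD => //; exact: square_integrableN. Qed.

Lemma integral_sqnormc_ae f g : measurable_cfun f -> measurable_cfun g ->
  (\forall t \ae nu, f t = g t) ->
  (\int[nu]_t (sqnormc (f t))%:E = \int[nu]_t (sqnormc (g t))%:E)%E.
Proof.
move=> mf mg fg; apply: ge0_ae_eq_integral => //.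
- exact/measurable_EFinP/measurable_sqnormc.
- exact/measurable_EFinP/measurable_sqnormc.
- by move=> t _; rewrite lee_fin sqnormc_ge0.
- by move=> t _; rewrite lee_fin sqnormc_ge0.
- by apply: filterS fg => t ->.
Qed.

Lemma L2_sqnormBE x y :
  (L2_sqnorm (x - y))%:E = (\int[nu]_t (sqnormc (x t - y t))%:E)%E.
Proof.
rewrite L2_sqnormE; apply: integral_sqnormc_ae (L2_subE x y).
- exact: L2_measurable.
- by case: (square_integrableB (L2_square_integrable x) (L2_square_integrable y)).
Qed.

Lemma limn_einf_le (u : nat -> \bar R) (M : \bar R) k :
  (forall n, (k <= n)%N -> (u n <= M)%E) -> (limn_einf u <= M)%E.
Proof.
move=> uM; rewrite limn_einf_lim; apply: lime_le; first exact: is_cvg_einfs.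
apply: nearW => n; apply: (@le_trans _ _ (u (n + k)%N)).
  by apply: ereal_inf_lbound; exists (n + k)%N => //=; exact: leq_addr.
by apply: uM; exact: leq_addl.
Qed.

Lemma sqnormc_cvg (z : nat -> R[i]) (a b : R) (w : R[i]) :
  (fun n => complex.Re (z n)) @ \oo --> a -> (fun n => complex.Im (z n)) @ \oo --> b ->
  (fun n => sqnormc (z n - w)) @ \oo --> sqnormc ((a +i* b)%C - w).
Proof.
move=> za zb; rewrite /sqnormc; under eq_fun do rewrite !raddfB/=.
rewrite !raddfB/= !expr2.
by apply: cvgD; apply: cvgM; apply: cvgB => //; exact: cvg_cst.
Qed.

(** Markov's inequality for the squared modulus. *)
Lemma measure_ge_le_L2_sqnorm (e : R) x y : 0 < e ->
  (nu [set t | (e <= sqnormc (x t - y t))%R] <= (L2_sqnorm (x - y) / e)%:E)%E.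
Proof.
move=> e0; rewrite EFinM lee_pdivlMr// muleC L2_sqnormBE.
have mxy : measurable_cfun (fun t => x t - y t).
  by case: (square_integrableB (L2_square_integrable x) (L2_square_integrable y)).
have := @le_integral_abse _ _ _ nu setT measurableT
  (fun t => (sqnormc (x t - y t))%:E) e _ e0.
rewrite setTI; under eq_set do rewrite gee0_abs ?lee_fin ?sqnormc_ge0//.
under eq_integral do rewrite gee0_abs ?lee_fin ?sqnormc_ge0//.
by apply; apply/measurable_EFinP/measurable_sqnormc.
Qed.

(** Riesz-Fischer: the real and imaginary parts converge almost everywhere, and Fatou's lemma
    carries the distance bounds to the limit. *)
Lemma L2_fast_cvg (x : nat -> L2) :
  (forall k l, (k <= l)%N -> L2_sqnorm (x k - x l) <= 16^-1 ^+ k) ->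
  exists y : L2, forall k, L2_sqnorm (y - x k) <= 16^-1 ^+ k.
Proof.
move=> xk.
(* By Markov at threshold 4^-k for the squared modulus, the rate 16^-k leaves mass at most 4^-k,
   within the 2^-k that [fast_cvg_ae] allows. *)
have pow k : 16^-1 ^+ k / (2^-1 ^+ k) ^+ 2 <= 2^-1 ^+ k :> R.
  have -> : (16^-1 : R) = 2^-1 ^+ 4 by rewrite exprVn -natrX.
  rewrite ler_pdivrMr ?exprn_gt0// -!exprM -exprD ler_wiXn2l//; try lra.
  by rewrite -mulnS [leqLHS]mulnC leq_mul2r orbT.
have mset (h : Y -> R) (e : R) : measurable_fun setT h -> measurable [set t | e <= h t].
  move=> mh; rewrite (_ : [set t | _] = h @^-1` `[e, +oo[).
    by rewrite -[X in measurable X]setTI; exact: mh.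
  by apply/seteqP; split => t /=; rewrite in_itv/= andbT.
have xB k l : square_integrable nu (fun t => x k t - x l t).
  by apply: square_integrableB; exact: L2_square_integrable.
have part (p : R[i] -> R) : (forall z w : R[i], p (z - w) = p z - p w) ->
    (forall z : R[i], p z ^+ 2 <= sqnormc z) ->
    (forall k, measurable_fun setT (fun t => p (x k t))) ->
    exists2 F : Y -> R, measurable_fun setT F &
      \forall t \ae nu, (fun k => p (x k t)) @ \oo --> F t.
  move=> pB ple mp; apply: fast_cvg_ae => // k.
  have e0 : 0 < (2^-1 ^+ k) ^+ 2 :> R by rewrite !exprn_gt0.
  apply: (@le_trans _ _ (nu [set t | ((2^-1 ^+ k) ^+ 2 <= sqnormc (x k t - x k.+1 t))%R])).
    rewrite le_measure ?inE//.
    - by apply: mset; apply: measurableT_comp => //; exact: measurable_funB.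
    - by apply: mset; apply: measurable_sqnormc; case: (xB k k.+1).
    - move=> t /=; rewrite distrC -pB => kt; apply: le_trans (ple _).
      by rewrite -[leRHS]real_normK ?num_real// ler_pXn2r// nnegrE ?exprn_ge0.
  apply: le_trans (measure_ge_le_L2_sqnorm _ _ e0) _.
  by rewrite lee_fin (le_trans _ (pow k))// ler_pM2r ?invr_gt0// xk.
have [Fr mFr xFr] := part (@complex.Re R) (fun z w : R[i] => raddfB _ z w)
  (fun z : R[i] => ler_wpDr (sqr_ge0 _) (lexx _)) (fun k => (L2_measurable (x k)).1).
have [Fi mFi xFi] := part (@complex.Im R) (fun z w : R[i] => raddfB _ z w)
  (fun z : R[i] => ler_wpDl (sqr_ge0 _) (lexx _)) (fun k => (L2_measurable (x k)).2).
pose F t := (Fr t +i* Fi t)%C.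
have mF : measurable_cfun F by [].
have mFx k : measurable_cfun (fun t => F t - x k t).
  apply: measurable_cfunD => //; split; under eq_fun do rewrite raddfN.
    by apply: measurableT_comp => //; exact: (L2_measurable (x k)).1.
  by apply: measurableT_comp => //; exact: (L2_measurable (x k)).2.
(* Fatou in [m], with [k] fixed: [h m] tends to the integrand almost everywhere and all its
   integrals with [k <= m] obey the bound. *)
have FxE k : (\int[nu]_t (sqnormc (F t - x k t))%:E <= (16^-1 ^+ k)%:E)%E.
  pose h m t := (sqnormc (x m t - x k t))%:E.
  have mh m : measurable_fun setT (h m).
    by apply/measurable_EFinP/measurable_sqnormc; case: (xB m k).
  have h0 m t : setT t -> (0 <= h m t)%E by move=> _; rewrite lee_fin sqnormc_ge0.
  rewrite (@ge0_ae_eq_integral _ _ _ nu setT _ (fun t => limn_einf (h ^~ t)))//.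
  - apply: le_trans (fatou _ _ mh h0) _ => //.
    apply: (@limn_einf_le _ _ k) => m km; rewrite -L2_sqnormBE lee_fin.
    by rewrite -opprB -scaleN1r L2_sqnormZ sqnormcN /sqnormc/= expr0n/= addr0
      expr1n mul1r xk.
  - exact/measurable_EFinP/measurable_sqnormc.
  - apply: measurableT_comp => //; apply: measurable_fun_limn_esup => m.
    exact: measurableT_comp.
  - by move=> t _; rewrite lee_fin sqnormc_ge0.
  - move=> t _; rewrite limn_einf_lim; apply: lime_ge; first exact: is_cvg_einfs.
    by apply: nearW => n; apply: le_ereal_inf_tmp => _ [m _ <-]; exact: h0.
  - apply: filterS2 xFr xFi => t ar ai _.
    have ht : h ^~ t @ \oo --> (sqnormc (F t - x k t))%:E.
      by apply: cvg_EFin; [exact: nearW|exact: sqnormc_cvg].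
    by rewrite (cvg_limn_einf_sup ht).1.
have sFx k : square_integrable nu (fun t => F t - x k t).
  split=> //; apply/integrableP; split.
    exact/measurable_EFinP/measurable_sqnormc.
  under eq_integral do rewrite gee0_abs ?lee_fin ?sqnormc_ge0//.
  by apply: le_lt_trans (FxE k) _; rewrite ltry.
have sF : square_integrable nu F.
  rewrite (_ : F = fun t => (F t - x 0%N t) + x 0%N t).
    by apply: square_integrableD => //; exact: L2_square_integrable.
  by apply/funext => t; rewrite subrK.
exists (L2_class nu F) => k; rewrite -lee_fin L2_sqnormBE; apply: le_trans (FxE k).
rewrite (@integral_sqnormc_ae _ (fun t => F t - x k t))//.
  by case: (square_integrableB (L2_square_integrable (L2_class nu F))
    (L2_square_integrable (x k))).
by apply: filterS (L2_classE sF) => t ->.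
Qed.

Lemma L2_sqnormN x y : L2_sqnorm (x - y) = L2_sqnorm (y - x).
Proof.
by rewrite -opprB -scaleN1r L2_sqnormZ sqnormcN /sqnormc/= expr0n/= addr0
  expr1n mul1r.
Qed.

Lemma L2_ballP x y (r : R) : ball x r%:C%C y <-> L2_norm (x - y) < r.
Proof. by rewrite -ltcR -(@ball_normE _ L2). Qed.

Lemma L2_norm_distC x y : L2_norm (x - y) = L2_norm (y - x).
Proof. by rewrite /L2_norm L2_sqnormN. Qed.

Lemma L2_norm_triangle y x z : L2_norm (x - z) <= L2_norm (x - y) + L2_norm (y - z).
Proof.
have -> : x - z = (x - y) + (y - z) by rewrite addrA subrK.
exact: L2_normD.
Qed.

Lemma L2_norm_le x (r : R) : 0 <= r -> (L2_norm x <= r) = (L2_sqnorm x <= r ^+ 2).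
Proof.
move=> r0; rewrite -(@ler_pXn2r _ 2)// ?nnegrE ?sqrtr_ge0//.
by rewrite sqr_sqrtr// L2_sqnorm_ge0.
Qed.

(** Balls belonging to the filter meet pairwise, so their centres form a fast sequence; its limit
    attracts the whole filter. *)
Fact L2_complete (F : set_system L2) : ProperFilter F -> cauchy F -> cvg F.
Proof.
move=> FF /cauchyP Fc.
(* Two such radii add up to at most 4^-k, whose square is the rate 16^-k of [L2_fast_cvg]. *)
pose r k : R := 4^-1 ^+ k / 2.
have r0 k : 0 < r k by rewrite divr_gt0 ?exprn_gt0.
have E16 k : 16^-1 ^+ k = (4^-1 ^+ k) ^+ 2 :> R.
  by rewrite -exprM mulnC exprM; congr (_ ^+ _); rewrite exprVn -natrX.
have /choice[x Fx] : forall k, exists x, F (ball x (r k)%:C%C).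
  by move=> k; apply: Fc; rewrite ltcR.
have xk k l : (k <= l)%N -> L2_sqnorm (x k - x l) <= 16^-1 ^+ k.
  move=> kl; have [z [/L2_ballP xkz /L2_ballP xlz]] := filter_ex (filterI (Fx k) (Fx l)).
  rewrite E16 -L2_norm_le ?exprn_ge0//.
  apply: le_trans (L2_norm_triangle z _ _) _.
  have rl : r l <= r k by rewrite /r ler_pM2r// ler_wiXn2l//; lra.
  have -> : 4^-1 ^+ k = r k + r k by rewrite /r -splitr.
  apply: lerD; first exact: ltW.
  by rewrite L2_norm_distC; exact: le_trans (ltW xlz) rl.
have [y yx] := L2_fast_cvg xk.
apply/cvg_ex; exists y; apply/cvg_ballP => e /complex_gt0[-> e0].
have [k ke] : exists k, 4^-1 ^+ k + r k < complex.Re e.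
  have : (fun k => 4^-1 ^+ k + r k) @ \oo --> (0 + 0 / 2 : R).
    by apply: cvgD; [|apply: cvgMr_tmp]; apply: cvg_expr; rewrite ger0_norm//; lra.
  rewrite mul0r addr0 => /cvgrPdist_lt/(_ _ e0)[k _ /(_ k (leqnn k))].
  rewrite sub0r normrN ger0_norm; first by exists k.
  by rewrite addr_ge0 ?exprn_ge0// ltW.
apply: filterS (Fx k) => z /L2_ballP xz; apply/L2_ballP.
apply: le_lt_trans (L2_norm_triangle (x k) _ _) _; apply: lt_trans ke.
by rewrite ler_ltD// L2_norm_le ?exprn_ge0// -E16.
Qed.

HB.instance Definition _ := Uniform_isComplete.Build L2 L2_complete.

Fact L2_hdot_normE x : `|x| ^+ 2 = L2_dot x x.
Proof. by rewrite L2_normE L2_dotxx -rmorphXn sqr_sqrtr// L2_sqnorm_ge0. Qed.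

HB.instance Definition _ := CompleteNormedModule_isHilbert.Build R L2
  (hdot := @L2_dot _ _ _ nu : {dot L2 for @conjc R}) L2_hdot_normE.

End L2_hilbert.

(** * Approximation in standard Borel probability spaces *)

Definition generates_measurable d (X : measurableType d) (B : nat -> set X) :=
  @measurable d X `<=` <<s range B >>.

Definition separates_points X (B : nat -> set X) :=
  forall x y, (forall n, B n x <-> B n y) -> x = y.

Lemma separable_metric_base (R : realType) (M : metricType R) :
  separable_space M -> exists V : nat -> set M, (forall n, open (V n)) /\
    forall (U : set M) w, open U -> U w -> exists n, V n w /\ V n `<=` U.
Proof.
move=> [D /countable_injP[f finj] dD].
(* The centre is referred to by its number under the injection [f], so that the balls are indexed by
   a countable type; injectivity recovers the centre below. *)
pose W (p : nat * nat) : set M :=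
  [set w | exists2 x, D x /\ f x = p.1 & mdist x w < p.2.+1%:R^-1].
have oW p : open (W p).
  rewrite openE => w [x [Dx fx] xw]; apply/nbhs_ballP.
  exists (p.2.+1%:R^-1 - mdist x w); first by rewrite /= subr_gt0.
  move=> w'; rewrite ballEmdist/= => ww'; exists x => //.
  by rewrite (le_lt_trans (metric_triangle _ w _))// -ltrBrDl.
exists (fun n => if choice.unpickle n is Some p then W p else set0); split.
  by move=> n; case: choice.unpickle => [p|]; [exact: oW|exact: open0].
move=> U w oU Uw.
have /nbhs_ballP[e /= e0 eU] : nbhs w U by move: oU; rewrite openE => /(_ w Uw).
have e20 : 0 < e / 2 by rewrite divr_gt0.
have [k ke] : exists k, k.+1%:R^-1 < e / 2 :> R.
  have /cvgrPdist_lt/(_ _ e20)[k _ /(_ k (leqnn k))] := @cvg_harmonic R.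
  by rewrite sub0r normrN ger0_norm ?invr_ge0 ?ler0n// => ke; exists k.
have k0 : 0 < k.+1%:R^-1 :> R by rewrite invr_gt0.
have [x [/interior_subset xw Dx]] : (ball w k.+1%:R^-1)^° `&` D !=set0.
  apply: dD; last exact: open_interior.
  by exists w; apply: (nbhsx_ballx w).
exists (choice.pickle (f x, k)); rewrite choice.pickleK; split.
  by exists x => //=; move: xw; rewrite ballEmdist/= metric_sym.
move=> w' [x' [Dx' /= fx'] x'w']; have xx' : x' = x by apply: finj; rewrite ?inE.
apply: eU; rewrite ballEmdist/= (le_lt_trans (metric_triangle _ x _))//.
rewrite [e]splitr ltrD//; last by rewrite -xx' (lt_trans x'w').
by move: xw; rewrite ballEmdist/= => /lt_trans; apply.
Qed.

(** Good sets principle: a property of preimages of Borel sets need only be checked on open sets. *)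
Lemma sigma_algebra_preimage_system (X P : Type) (g : X -> P) (G : set (set X)) :
  sigma_algebra setT G -> sigma_algebra setT [set U : set P | G (g @^-1` U)].
Proof.
move=> [G0 GC GU]; split=> /=; first by rewrite preimage_set0.
  by move=> A GA; rewrite setTD preimage_setC -setTD; exact: GC.
by move=> A GA; rewrite preimage_bigcup; exact: GU.
Qed.

Lemma standard_borel_generators (R : realType) d (X : measurableType d) :
  standard_borel R X -> exists B : nat -> set X,
    [/\ forall n, measurable (B n), generates_measurable B & separates_points B].
Proof.
move=> [P [g [[M [h [k [[hK kK ch ck] [_ sM]]]]] bg mX]]].
have [V [oV baseV]] := separable_metric_base sM.
pose B n := g @^-1` (h @^-1` V n).
exists B; split=> [n|A /mX[C sC ->]|x y xy].
- apply/mX; exists (h @^-1` V n) => //; apply: sub_sigma_algebra.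
  by move: ch => /continuousP; exact.
- have := sigma_algebra_preimage_system g (smallest_sigma_algebra setT (range B)).
  move=> /smallest_sub; apply; last exact: sC.
  move=> U oU /=.
  (* An open set is the union of the basic sets inside it; the empty set fills the other indices so
     that the union runs over all of nat. *)
  have -> : g @^-1` U = \bigcup_n (if pselect (B n `<=` g @^-1` U) then B n else set0).
    apply/seteqP; split => [x Ux|x [n _]]; last first.
      by case: pselect => //= BU; exact: BU.
    have oU' : open (k @^-1` U) by move: ck => /continuousP; exact.
    have [|n [Vn VU]] := baseV _ (h (g x)) oU'; first by rewrite /= hK.
    exists n => //; case: pselect => //=; case=> y By.
    by have := VU _ By; rewrite /= hK.
  apply: sigma_algebra_bigcup => n; case: pselect => ? /=.
    by apply: sub_sigma_algebra; exists n.
  exact: sigma_algebra0.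
- apply: contrapT => nxy.
  have hxy : h (g x) != h (g y).
    by apply/eqP => /(can_inj hK)/(bij_inj bg).
  (* The ball around the first point whose radius is the distance to the second misses the second,
     so a basic set inside it separates them. *)
  have oxy : open (ball (h (g x)) (mdist (h (g x)) (h (g y))))^° := @open_interior _ _.
  have [|n [Vx Vsub]] := baseV _ (h (g x)) oxy.
    by apply: nbhsx_ballx; rewrite mdist_gt0.
  have /Vsub/interior_subset : V n (h (g y)) by exact/(xy n).
  by rewrite ballEmdist/= ltxx.
Qed.

(** * Finite codes and approximation of measurable sets *)

Section codes.
Context d (X : measurableType d) (R : realType) (mu : probability X R).
Variable B : nat -> set X.
Hypothesis mB : forall n, measurable (B n).

(** The fibres are the atoms of generation [n]. Some codes may have an empty fibre, which later
    proofs treat separately. *)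
Definition code n x : {ffun 'I_n -> bool} := [ffun i : 'I_n => `[< B i x >]].

Lemma codeP n x y : code n x = code n y <->
  forall i, (i < n)%N -> (B i x <-> B i y).
Proof.
split=> [/ffunP xy i ilt|xy].
  have := xy (Ordinal ilt); rewrite !ffunE/= => xyi; split=> /asboolP.
    by rewrite xyi => /asboolP.
  by rewrite -xyi => /asboolP.
by apply/ffunP => i; rewrite !ffunE; apply/asbool_equiv_eq/xy.
Qed.

Lemma code_le n m x y : (n <= m)%N -> code m x = code m y -> code n x = code n y.
Proof. by move=> nm /codeP xy; apply/codeP => i /leq_trans/(_ nm)/xy. Qed.

Lemma measurable_code n (a : {ffun 'I_n -> bool}) : measurable [set x | code n x = a].
Proof.
rewrite (_ : [set x | _] = \bigcap_(i in [set i : 'I_n | true])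
    (if a i then B i else ~` B i)).
  apply: fin_bigcap_measurable => [|i _]; first exact: finite_finset.
  by case: (a i) => //; exact: measurableC.
apply/seteqP; split => [x /= <- i _|x /= xa].
  by rewrite ffunE; case: ifPn => /asboolP.
apply/ffunP => i; rewrite ffunE; have := xa i isT.
by case: (a i) => [/asboolP//|nB]; exact/asboolP.
Qed.

(** Taking [T := Prop] covers sets, the unions of atoms; membership is then compared by equality of
    propositions. *)
Definition code_invariant T n (f : X -> T) := forall x y, code n x = code n y -> f x = f y.

Lemma code_invariant_le T n m (f : X -> T) : (n <= m)%N ->
  code_invariant n f -> code_invariant m f.
Proof. by move=> nm nf x y /(code_le nm)/nf. Qed.

Lemma measurable_code_pred n (A : pred {ffun 'I_n -> bool}) :
  measurable [set x | A (code n x)].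
Proof.
rewrite (_ : [set x | _] = \bigcup_(a in [set a | A a]) [set x | code n x = a]).
  by apply: fin_bigcup_measurable => // a _; exact: measurable_code.
by apply/seteqP; split => [x Ax|x [a Aa /= ->]//]; exists (code n x).
Qed.

Lemma measurable_code_invariant n (A : set X) : code_invariant n A -> measurable A.
Proof.
move=> nA.
pose S a := `[< exists2 y, A y & code n y = a >].
rewrite (_ : A = [set x | S (code n x)]); first exact: (measurable_code_pred S).
apply/seteqP; split => [x Ax|x /= /asboolP[y Ay /nA Ayx]]; last by rewrite -Ayx.
by apply/asboolP; exists x.
Qed.

Lemma measurable_fun_code_invariant d' (T : measurableType d') n (f : X -> T) :
  code_invariant n f -> measurable_fun setT f.
Proof.
move=> nf _ C _; rewrite setTI; apply: (@measurable_code_invariant n) => x y xy.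
by rewrite /preimage /= (nf x y).
Qed.

Definition symdiff (A A' : set X) := (A `\` A') `|` (A' `\` A).

Lemma measurable_symdiff A A' : measurable A -> measurable A' -> measurable (symdiff A A').
Proof. by move=> mA mA'; apply: measurableU; exact: measurableD. Qed.

Definition code_approximable (A : set X) := measurable A /\
  forall e : R, 0 < e -> exists n A', code_invariant n A' /\ (mu (symdiff A A') < e%:E)%E.

Lemma code_approximableC A : code_approximable A -> code_approximable (~` A).
Proof.
move=> [mA aA]; split; first exact: measurableC.
move=> e /aA[n [A' [nA' AA']]]; exists n, (~` A'); split.
  by move=> x y /nA' xy; rewrite /setC /= xy.
by rewrite /symdiff !setDE !setCK [X in mu X]setUC !(setIC (~` _)).
Qed.

Lemma measure_lt_cover (A A1 A2 : set X) (e1 e2 : R) :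
  measurable A -> measurable A1 -> measurable A2 -> A `<=` A1 `|` A2 ->
  (mu A1 < e1%:E)%E -> (mu A2 < e2%:E)%E -> (mu A < (e1 + e2)%:E)%E.
Proof.
move=> mA mA1 mA2 sA A1e A2e; rewrite EFinD; apply: le_lt_trans (lteD A1e A2e).
apply: le_trans (measureU2 _ mA1 mA2); rewrite le_measure ?inE//.
exact: measurableU.
Qed.

Lemma code_approximableU A1 A2 : code_approximable A1 -> code_approximable A2 ->
  code_approximable (A1 `|` A2).
Proof.
move=> [mA1 aA1] [mA2 aA2]; split; first exact: measurableU.
move=> e e0; have e20 : 0 < e / 2 by rewrite divr_gt0.
have [n1 [A1' [nA1 A1e]]] := aA1 _ e20; have [n2 [A2' [nA2 A2e]]] := aA2 _ e20.
have mA1' := measurable_code_invariant nA1; have mA2' := measurable_code_invariant nA2.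
exists (maxn n1 n2), (A1' `|` A2'); split.
  move=> x y xy; rewrite /setU /=.
  by rewrite (code_invariant_le (leq_maxl _ _) nA1 xy) (code_invariant_le (leq_maxr _ _) nA2 xy).
rewrite [e]splitr; apply: measure_lt_cover A1e A2e.
- by apply: measurable_symdiff; exact: measurableU.
- exact: measurable_symdiff.
- exact: measurable_symdiff.
- move=> x [[[?|?] /not_orP[? ?]]|[[?|?] /not_orP[? ?]]].
  + by left; left.
  + by right; left.
  + by left; right.
  + by right; right.
Qed.

Lemma code_approximable0 : code_approximable set0.
Proof.
split=> // e e0; exists 0%N, set0; split=> //.
by rewrite /symdiff setDv setU0 measure0 lte_fin.
Qed.

(** Continuity from above: the remainders decrease to the empty set. *)
Lemma measure_bigcup_tail (F : nat -> set X) (e : R) : (forall k, measurable (F k)) ->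
  0 < e -> exists N,
    (mu ((\bigcup_k F k) `\` \bigcup_(k in [set k | (k < N)%N]) F k) < e%:E)%E.
Proof.
move=> mF e0; pose G n := \bigcup_(k in [set k | (k < n)%N]) F k.
pose H n := (\bigcup_k F k) `\` G n.
have mH n : measurable (H n) by apply: measurableD; exact: bigcup_measurable.
have H0 : \bigcap_n H n = set0.
  apply/seteqP; split => // x Hx; have [] := Hx 0%N I => -[k _ Fx] _.
  by have [_] := Hx k.+1 I; apply; exists k => /=.
have : mu \o H @ \oo --> mu (\bigcap_n H n).
  apply: nonincreasing_cvg_mu => //.
  - by rewrite -ge0_fin_numE// fin_num_measure.
  - by rewrite H0.
  - move=> n m nm; apply/subsetPset => x [Ux nGx]; split=> // -[k /= kn Fx].
    by apply: nGx; exists k => //=; exact: leq_trans kn nm.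
rewrite H0 measure0 => /fine_cvgP[_ /cvgrPdist_lt/(_ _ e0)[N _ /(_ N (leqnn N))]].
rewrite sub0r normrN ger0_norm ?fine_ge0// => HN; exists N.
by rewrite -lte_fin fineK ?fin_num_measure in HN.
Qed.

Lemma code_approximable_bigcup (F : nat -> set X) :
  (forall k, code_approximable (F k)) -> code_approximable (\bigcup_k F k).
Proof.
move=> aF; have mF k : measurable (F k) by case: (aF k).
have mU : measurable (\bigcup_k F k) by exact: bigcup_measurable.
split=> // e e0; have e20 : 0 < e / 2 by rewrite divr_gt0.
pose G n := \bigcup_(k in [set k | (k < n)%N]) F k.
have mG n : measurable (G n) by exact: bigcup_measurable.
have aG n : code_approximable (G n).
  elim: n => [|n IHn].
    rewrite (_ : G 0%N = set0); first exact: code_approximable0.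
    by apply/seteqP; split => [x []|].
  rewrite (_ : G n.+1 = G n `|` F n); first exact: code_approximableU.
  apply/seteqP; split => [x [k /=]|x [[k /= kn]|]].
  - by rewrite ltnS leq_eqVlt => /predU1P[->|kn]; [right|left; exists k].
  - by exists k => //=; rewrite ltnS ltnW.
  - by exists n => //=.
have UG : \bigcup_n G n = \bigcup_k F k.
  apply/seteqP; split => [x [n _ [k _ ?]]|x [k _ ?]]; first by exists k.
  by exists k.+1 => //; exists k => /=.
have [N GNe] := measure_bigcup_tail mF e20.
have [_ /(_ _ e20)[n [A' [nA' GA']]]] := aG N.
have mA' := measurable_code_invariant nA'.
exists n, A'; split=> //; rewrite [e]splitr; apply: measure_lt_cover GNe GA'.
- exact: measurable_symdiff.
- by apply: measurableD => //; exact: (mG N).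
- exact: measurable_symdiff.
- move=> x [[Ux nA'x]|[A'x nUx]]; last first.
    by right; right; split=> // -[k _ Fx]; apply: nUx; exists k.
  by have [Gx|nGx] := pselect (G N x); [right; left|left].
Qed.

Hypothesis gB : generates_measurable B.

(** The approximable sets form a sigma-algebra containing every [B n]. *)
Lemma measurable_code_approximable A : measurable A -> code_approximable A.
Proof.
move=> /gB; apply: (@smallest_sub _ (sigma_algebra setT)).
  split; first exact: code_approximable0.
    by move=> C aC; rewrite setTD; exact: code_approximableC.
  exact: code_approximable_bigcup.
(* A code of length [n] only sees indices below [n], hence the successor. *)
move=> _ [n _ <-]; split=> // e e0; exists n.+1, (B n); split.
  by move=> x y /codeP/(_ n (ltnSn n)) xy; exact/propext.
by rewrite /symdiff setDv setU0 measure0 lte_fin.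
Qed.

End codes.

Lemma circle_dense_seq (R : realType) : exists z : nat -> circle R,
  forall (w : circle R) e, 0 < e -> exists j, mdist (z j) w < e.
Proof.
pose box (q : rat * rat * rat) : set (circle R) := [set z |
  `|complex.Re (circle_val z) - ratr q.1.1| < ratr q.2 /\
  `|complex.Im (circle_val z) - ratr q.1.2| < ratr q.2].
(* One point of the circle is chosen in each rational box that meets it, since the centre of the box
   need not lie on the circle. *)
pose z n := if choice.unpickle n is Some q then xget 1%g (box q) else 1%g.
exists z => w e e0.
(* Two points of a box differ by less than 2r in each of the two coordinates. *)
have [r] := @rat_in_itvoo R 0 (e / 4) (divr_gt0 e0 (ltr0Sn _ 3)).
rewrite in_itv/= => /andP[r0 re].
have near_rat (x : R) : exists a : rat, `|x - ratr a| < ratr r.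
  have [|a] := @rat_in_itvoo R (x - ratr r) (x + ratr r).
    by rewrite ltrBlDr -addrA ltrDl addr_gt0.
  by rewrite in_itv/= -ltr_distlC => ?; exists a.
have [a wa] := near_rat (complex.Re (circle_val w)).
have [b wb] := near_rat (complex.Im (circle_val w)).
exists (choice.pickle (a, b, r)); rewrite /z choice.pickleK.
have := @xgetPex _ (1%g : circle R) (box (a, b, r)) (ex_intro _ w (conj wa wb)).
set v := xget _ _ => -[/= va vb].
rewrite mdist_circleE (le_lt_trans (normc_le_ReIm _))// !raddfB/=.
have := ler_distD (ratr a) (complex.Re (circle_val v)) (complex.Re (circle_val w)).
have := ler_distD (ratr b) (complex.Im (circle_val v)) (complex.Im (circle_val w)).
rewrite (distrC (ratr a)) (distrC (ratr b)); lra.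
Qed.

(** * Countably many dense simple functions, and atoms of small mass *)

Section L0_density.
Context d (X : measurableType d) (R : realType) (mu : probability X R).

Definition circle_mfun (f : X -> circle R) (mf : measurable_fun setT f) :
    {mfun X >-> circle R} := HB.pack f (isMeasurableFun.Build _ _ _ _ _ mf).

Lemma measurable_mdist_ge (f g : X -> circle R) (e : R) :
  measurable_fun setT f -> measurable_fun setT g ->
  measurable [set x | e <= mdist (f x) (g x)].
Proof.
by move=> mf mg; exact: (measurable_circle_mdist_ge (circle_mfun mf) (circle_mfun mg)).
Qed.

Lemma measure_ae_eq (A A' : set X) : measurable A -> measurable A' ->
  (\forall x \ae mu, A x <-> A' x) -> mu A = mu A'.
Proof.
move=> mA mA' AA'; rewrite -[A]setIT -[A']setIT -!integral_indic//.
apply: ge0_ae_eq_integral => //; [exact/measurable_EFinP/measurable_indic..|].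
apply: filterS AA' => x /propext Ax _; rewrite !indicE; congr ((_ _)%:R%:E).
by apply/idP/idP; rewrite !inE Ax.
Qed.

Lemma L0_ball_class (f : L0_circle mu) (g : {mfun X >-> circle R}) (e : R) :
  L0_ball f e (L0_class mu g) <-> (mu [set x | (e <= mdist (repr f x) (g x))%R] < e%:E)%E.
Proof.
rewrite /L0_ball/= (@measure_ae_eq _ [set x | e <= mdist (repr f x) (g x)])//.
- exact: measurable_circle_mdist_ge.
- exact: measurable_circle_mdist_ge.
- by apply: filterS (L0_classP mu g) => x /= -> .
Qed.

Variable B : nat -> set X.
Hypothesis mB : forall n, measurable (B n).
Variable z : nat -> circle R.

Lemma code_invariant_comp T n (F : {ffun 'I_n -> bool} -> T) :
  code_invariant B n (fun x => F (code B n x)).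
Proof. by move=> x y ->. Qed.

(** Values are given by indices into [z], so that for each [n] the parameters form a countable type;
    separability of L0 follows. *)
Definition circle_simple n (phi : {ffun {ffun 'I_n -> bool} -> nat}) :
    {mfun X >-> circle R} :=
  circle_mfun (measurable_fun_code_invariant mB
    (code_invariant_comp (n := n) (fun a => z (phi a)))).

Hypothesis gB : generates_measurable B.
Hypothesis zdense : forall (w : circle R) e, 0 < e -> exists j, mdist (z j) w < e.

(** Induction on [N]: the new [g] takes the value [z N] on a union of atoms approximating the set
    where [z N] is close to f, and is unchanged elsewhere. New errors lie in the symmetric
    difference of these two sets, so half of [r] goes to them and half to the old errors. *)
Lemma simple_approx_upto (f : X -> circle R) (e : R) N (r : R) :
  measurable_fun setT f -> 0 < r -> exists n (g : X -> circle R),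
  [/\ code_invariant B n g, forall x, exists j, g x = z j &
  (mu ((\bigcup_(j in [set j | (j < N)%N]) [set x | (mdist (z j) (f x) < e)%R]) `&`
     [set x | (e <= mdist (f x) (g x))%R]) < r%:E)%E].
Proof.
move=> mf; pose C j := [set x | mdist (z j) (f x) < e].
have mC j : measurable (C j).
  rewrite (_ : C j = ~` [set x | e <= mdist (cst (z j) x) (f x)]).
    by apply: measurableC; exact: measurable_mdist_ge.
  by apply/seteqP; split => x /=; rewrite /C/= ltNge => /negP.
have mU M (g : X -> circle R) : measurable_fun setT g ->
    measurable ((\bigcup_(j in [set j | (j < M)%N]) C j) `&`
      [set x | e <= mdist (f x) (g x)]).
  move=> mg; apply: measurableI; first exact: bigcup_measurable.
  exact: measurable_mdist_ge.
elim: N r => [|N IHN] r r0.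
  exists 0%N, (cst (z 0%N)); split=> // [x|]; first by exists 0%N.
  rewrite (_ : _ `&` _ = set0) ?measure0 ?lte_fin//.
  by apply/seteqP; split => // x [[]].
have r20 : 0 < r / 2 by rewrite divr_gt0.
have [n [g [ng gz gr]]] := IHN _ r20.
have [_ /(_ _ r20)[m [A' [mA' A'r]]]] := measurable_code_approximable mu mB gB (mC N).
have ng' : code_invariant B (maxn n m) (fun x => if pselect (A' x) then z N else g x).
  move=> x y xy; have Axy := code_invariant_le (leq_maxr n m) mA' xy.
  have gxy := code_invariant_le (leq_maxl n m) ng xy.
  by case: pselect => Ax /=; case: pselect => Ay //=; move: Ax; rewrite Axy.
exists (maxn n m), (fun x => if pselect (A' x) then z N else g x); split=> //.
  by move=> x; case: pselect => ? /=; [exists N|exact: gz].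
rewrite [r]splitr; apply: measure_lt_cover gr A'r.
- apply: mU; exact: measurable_fun_code_invariant ng'.
- by apply: mU; exact: measurable_fun_code_invariant ng.
- by apply: measurable_symdiff => //; exact: measurable_code_invariant mA'.
- move=> x [[j /= jN Cjx]]; case: pselect => A'x /= egx.
    right; right; split=> //= CNx.
    by move: egx; rewrite leNgt metric_sym CNx.
  have [CNx|nCNx] := pselect (C N x); first by right; left.
  left; split=> //; move: jN; rewrite ltnS leq_eqVlt => /predU1P[jN|jN].
    by rewrite jN in Cjx.
  by exists j.
Qed.

(** By density of [z] the sets [C j] cover X, and finitely many of them cover all but mass e/2; the
    simple approximation on these spends the other half. *)
Lemma L0_simple_dense (f : L0_circle mu) (e : R) : 0 < e ->
  exists n (phi : {ffun {ffun 'I_n -> bool} -> nat}),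
    L0_ball f e (L0_class mu (circle_simple phi)).
Proof.
move=> e0; have e20 : 0 < e / 2 by rewrite divr_gt0.
have mf : measurable_fun setT (repr f) by exact: measurable_funPT.
pose C j := [set x | mdist (z j) (repr f x) < e].
have mC j : measurable (C j).
  rewrite (_ : C j = ~` [set x | e <= mdist (cst (z j) x) (repr f x)]).
    by apply: measurableC; exact: measurable_mdist_ge.
  by apply/seteqP; split => x /=; rewrite /C/= ltNge => /negP.
have [N CN] := measure_bigcup_tail mu mC e20.
have [n [g [ng gz gr]]] := simple_approx_upto e N mf e20.
(* Codes that no point has receive the arbitrary index 0. *)
have /choice[phi phiP] : forall a : {ffun 'I_n -> bool}, exists j,
    forall x, code B n x = a -> g x = z j.
  move=> a; have [[x xa]|nx] := pselect (exists x, code B n x = a).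
    by have [j gj] := gz x; exists j => y ya; rewrite -gj; apply: ng; rewrite xa.
  by exists 0%N => x xa; case: nx; exists x.
exists n, (finfun phi); apply/L0_ball_class.
rewrite (_ : [set x | _] = [set x | e <= mdist (repr f x) (g x)]); last first.
  by apply/seteqP; split => x /=; rewrite ffunE -(phiP _ x erefl).
rewrite [e in ltRHS]splitr; apply: measure_lt_cover CN gr.
- by apply: measurable_mdist_ge => //; exact: measurable_fun_code_invariant ng.
- by apply: measurableD; apply: bigcup_measurable => j _; exact: mC.
- apply: measurableI; first by apply: bigcup_measurable => j _; exact: mC.
  by apply: measurable_mdist_ge => //; exact: measurable_fun_code_invariant ng.
- move=> x /= egx; have [Cx|Cx] := pselect ((\bigcup_(j in [set j | (j < N)%N]) C j) x).
    by right.
  left; split=> //; have [j zj] := zdense (repr f x) e0.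
  by exists j.
Qed.

Definition same_code n : set (X * X) := [set p | code B n p.1 = code B n p.2].

Lemma measurable_code2 n (A : pred ({ffun 'I_n -> bool} * {ffun 'I_n -> bool})) :
  measurable [set p : X * X | A (code B n p.1, code B n p.2)].
Proof.
rewrite (_ : [set p | _] = \bigcup_(a in [set a | A a])
    ([set x | code B n x = a.1] `*` [set x | code B n x = a.2])).
  apply: fin_bigcup_measurable => [|a _]; first exact: finite_finset.
  by apply: measurableX; exact: measurable_code.
apply/seteqP; split => [[x y] /= xy|[x y] [[a b] /= ab [/= xa ya]]].
  by exists (code B n x, code B n y).
by rewrite xa ya.
Qed.

Lemma measurable_same_code n : measurable (same_code n).
Proof.
rewrite (_ : same_code n =
  [set p | (fun a => a.1 == a.2) (code B n p.1, code B n p.2)]).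
  exact: (measurable_code2 (fun a => a.1 == a.2)).
by apply/seteqP; split => p /= /eqP.
Qed.

(** The intersection is the diagonal, whose sections are points. *)
Lemma bigcap_same_code0 : separates_points B -> diffuse mu ->
  (mu \x mu)%E (\bigcap_n same_code n) = 0%E.
Proof.
move=> sB diff; rewrite /product_measure1 integral0_eq// => x _.
rewrite /= (_ : xsection _ x = [set x]); first exact: diff.
apply/seteqP; split => y; rewrite /xsection /= inE; last by move=> -> n _.
by move=> xy; apply/esym/sB => n; have /codeP := xy n.+1 I; apply.
Qed.

(** For any atom A, the square A x A lies in [same_code n], so mu(A)^2 is at most the product
    measure of that set, which tends to 0. Passing to the square gives uniformity over the atoms. *)
Lemma small_atoms : separates_points B -> diffuse mu -> forall e : R, 0 < e ->
  exists n, forall x, (mu [set y | code B n y = code B n x] < e%:E)%E.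
Proof.
move=> sB diff e e0.
pose P : probability (X * X)%type R := (mu \x mu)%E.
have niE : nonincreasing_seq same_code.
  by move=> n m nm; apply/subsetPset => p; exact: code_le.
have : P \o same_code @ \oo --> P (\bigcap_n same_code n).
  apply: nonincreasing_cvg_mu => //.
  - by rewrite -ge0_fin_numE// fin_num_measure//; exact: measurable_same_code.
  - exact: measurable_same_code.
  - by apply: bigcap_measurableType => n _; exact: measurable_same_code.
rewrite -[X in _ --> X -> _]/((mu \x mu)%E _) bigcap_same_code0//.
move=> /fine_cvgP[_ /cvgrPdist_lt/(_ (e ^+ 2))].
rewrite exprn_gt0// => /(_ isT)[n _ /(_ n (leqnn n))].
rewrite sub0r normrN ger0_norm ?fine_ge0// => En; exists n => x.
pose A := [set y | code B n y = code B n x].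
have mA : measurable A by exact: measurable_code.
have : (mu A * mu A < (e ^+ 2)%:E)%E.
  rewrite -[X in (X < _)%E](product_measure1E mu mu)// -[X in (X < _)%E]/(P _).
  apply: (@le_lt_trans _ _ (P (same_code n))); last first.
    rewrite -(@fineK _ (P (same_code n))) ?lte_fin// fin_num_measure//.
    exact: measurable_same_code.
  rewrite le_measure ?inE//; [exact: measurableX|exact: measurable_same_code|].
  by move=> [y y'] [/= ya ya']; rewrite /same_code /= ya ya'.
rewrite -/A -(@fineK _ (mu A)) ?fin_num_measure// -EFinM !lte_fin -expr2.
by rewrite ltr_pXn2r// ?nnegrE ?fine_ge0// ltW.
Qed.

End L0_density.

(** * L0 is Polish *)

Section ky_fan.
Context d (X : measurableType d) (R : realType) (mu : probability X R).
Implicit Types f g h : L0_circle mu.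

Lemma L0_measurable f : measurable_fun setT (repr f).
Proof. exact: measurable_funPT. Qed.

Definition ky_fan f g : R := inf [set e : R | L0_ball f e g].

(** Total mass 1 is below 2, so the set of radii is nonempty and its [inf] is a genuine infimum. *)
Lemma L0_ball2 f g : L0_ball f 2 g.
Proof.
rewrite /L0_ball/=; apply: (@le_lt_trans _ _ 1%E); last by rewrite lte_fin; lra.
by apply: probability_le1; exact: measurable_circle_mdist_ge.
Qed.

Lemma L0_ball_has_inf f g : has_inf [set e : R | L0_ball f e g].
Proof.
by split; [exists 2; exact: L0_ball2|exists 0 => e /L0_ball_gt0/ltW].
Qed.

Lemma ky_fan_ge0 f g : 0 <= ky_fan f g.
Proof.
apply: lb_le_inf; first by exists 2; exact: L0_ball2.
by move=> e /L0_ball_gt0/ltW.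
Qed.

Lemma ky_fan_lt f g e : ky_fan f g < e -> L0_ball f e g.
Proof.
move=> /(inf_lt (L0_ball_has_inf f g).1)[r fgr re].
exact: L0_ballS (ltW re) fgr.
Qed.

Lemma ky_fan_le f g e : L0_ball f e g -> ky_fan f g <= e.
Proof. by move=> fg; apply: ge_inf => //; case: (L0_ball_has_inf f g). Qed.

Fact ky_fanxx f : ky_fan f f = 0.
Proof.
apply/eqP; rewrite eq_le ky_fan_ge0 andbT; apply/ler_addgt0Pl => e e0.
by rewrite addr0 ky_fan_le//; exact: L0_ball_center.
Qed.

Fact ky_fan_sym f g : ky_fan f g = ky_fan g f.
Proof.
rewrite /ky_fan; congr (inf _).
by apply/seteqP; split => e /=; exact: L0_ball_sym.
Qed.

Fact ky_fan_triangle g f h : ky_fan f h <= ky_fan f g + ky_fan g h.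
Proof.
apply/ler_addgt0Pl => e e0.
have e20 : 0 < e / 2 by rewrite divr_gt0.
rewrite [e]splitr addrACA.
apply: ky_fan_le; apply: (@L0_ball_triangle _ _ _ _ _ g).
  by apply: ky_fan_lt; rewrite ltrDr.
by apply: ky_fan_lt; rewrite ltrDr.
Qed.

Fact ky_fan_eq0 f g : ky_fan f g = 0 -> f = g.
Proof.
move=> fg0; apply: L0_eqP.
have fge e : 0 < e -> L0_ball f e g by move=> e0; apply: ky_fan_lt; rewrite fg0.
pose N k := [set x | k.+1%:R^-1 <= mdist (repr f x) (repr g x)].
have mN k : measurable (N k) by exact: measurable_circle_mdist_ge.
have N0 k : mu (N k) = 0%E.
  apply/eqP; rewrite eq_le measure_ge0 andbT; apply/lee_addgt0Pr => e e0.
  (* The radius of [L0_ball] bounds both distance and mass, so it must be below the threshold of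
     [N k] and below [e] at once. *)
  rewrite add0e; have m0 : 0 < Num.min e k.+1%:R^-1 by rewrite lt_min e0 invr_gt0/=.
  apply: (@le_trans _ _ (mu [set x | (Num.min e k.+1%:R^-1 <= mdist (repr f x) (repr g x))%R])).
    rewrite le_measure ?inE//; first exact: measurable_circle_mdist_ge.
    by move=> x; apply: le_trans; rewrite ge_min lexx orbT.
  apply: le_trans (ltW (fge _ m0)) _.
  by rewrite lee_fin ge_min lexx.
have : mu.-negligible (\bigcup_k N k).
  by apply: negligible_bigcup => k; apply/negligibleP => //; exact: N0.
apply: negligibleS => x /= fgx; have d0 : 0 < mdist (repr f x) (repr g x).
  by rewrite mdist_gt0; apply/eqP.
have /cvgrPdist_lt/(_ _ d0)[k _ /(_ k (leqnn k))] := @cvg_harmonic R.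
rewrite sub0r normrN ger0_norm ?invr_ge0 ?ler0n// => kd.
by exists k => //; exact: ltW.
Qed.

(** An alias, so that the metric structure does not compete with the pseudometric already attached
    to [L0_circle]. *)
Definition L0_ky_fan : Type := L0_circle mu.
HB.instance Definition _ := Choice.on L0_ky_fan.
HB.instance Definition _ := isMetric.Build R L0_ky_fan
  ky_fanxx ky_fan_eq0 ky_fan_sym ky_fan_triangle.

Lemma continuous_to_ky_fan : continuous (id : L0_circle mu -> L0_ky_fan).
Proof.
move=> f; apply: (@cvg_ballP _ _ _ _ (nbhs_filter f) _ _).2 => e e0.
have e20 : 0 < e / 2 by rewrite divr_gt0.
(* [ky_fan_le] is not strict, and halving restores the strict bound. *)
apply/nbhs_ballP; exists (e / 2) => //= g fg.
rewrite ballEmdist/=; apply: le_lt_trans (ky_fan_le fg) _.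
by rewrite ltr_pdivrMr// ltr_pMr//; lra.
Qed.

Lemma continuous_from_ky_fan : continuous (id : L0_ky_fan -> L0_circle mu).
Proof.
move=> f; apply: (@cvg_ballP _ _ _ _ (nbhs_filter f) _ _).2 => e e0.
by apply/nbhs_ballP; exists e => //= g; rewrite ballEmdist/= => /ky_fan_lt.
Qed.

(** The points where all terms from index N on are below [e] exhaust almost all of X as N grows. *)
Lemma ae_cvg0_in_measure (h : nat -> X -> R) (e r : R) :
  (forall n, measurable_fun setT (h n)) ->
  (\forall x \ae mu, h ^~ x @ \oo --> (0 : R)) -> 0 < e -> 0 < r ->
  exists N, forall n, (N <= n)%N -> (mu [set x | (e <= h n x)%R] < r%:E)%E.
Proof.
move=> mh h0 e0 r0.
have mlt n : measurable [set x | e <= h n x].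
  rewrite (_ : [set x | _] = h n @^-1` `[e, +oo[).
    by rewrite -[X in measurable X]setTI; exact: mh.
  by apply/seteqP; split => t /=; rewrite in_itv/= andbT.
pose G N := \bigcap_(n in [set n | (N <= n)%N]) ~` [set x | e <= h n x].
have mG N : measurable (G N).
  by apply: bigcap_measurableType => n _; exact: measurableC.
have GU : mu (~` \bigcup_N G N) = 0%E.
  apply: measure_negligible; first by apply: measurableC; exact: bigcup_measurable.
  apply: negligibleS h0 => x /= nGx hx; apply: nGx.
  have /cvgrPdist_lt/(_ _ e0)[N _ NP] := hx.
  exists N => // n /NP; rewrite sub0r normrN => hn /= enx.
  by have := le_lt_trans (ler_norm _) hn; rewrite ltNge enx.
have [N GN] := measure_bigcup_tail mu mG r0.
exists N => n Nn; apply: le_lt_trans GN.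
rewrite -[leRHS]adde0 -GU.
have mUN : measurable (\bigcup_(k in [set k | (k < N.+1)%N]) G k) by exact: bigcup_measurable.
have mD : measurable (\bigcup_k G k `\` \bigcup_(k in [set k | (k < N)%N]) G k).
  by apply: measurableD; apply: bigcup_measurable => k _; exact: mG.
have mC : measurable (~` \bigcup_N G N).
  by apply: measurableC; exact: bigcup_measurable.
apply: le_trans (measureU2 _ mD mC); rewrite le_measure ?inE//; first exact: measurableU.
move=> x /= enx; have [Gx|nGx] := pselect ((\bigcup_k G k) x); last by right.
left; split=> // -[k /= kN Gkx]; apply: (Gkx n) => //=.
exact: leq_trans (ltnW kN) Nn.
Qed.

(** The default 1 repairs limits of circle-valued functions, which have modulus 1 only almost
    everywhere. *)
Definition to_circle (z : R[i]) : circle R := insubd (1%g : circle R) z.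

Lemma to_circleE z : sqnormc z = 1 -> circle_val (to_circle z) = z.
Proof.
move=> z1; rewrite [LHS]val_insubd ifT// -[X in X == _]/((Normc.normc z)%:C%C).
rewrite (_ : Normc.normc z = 1)//; apply/eqP.
by rewrite -(@eqrXn2 _ 2)// ?normc_ge0// -sqnormcE z1 expr1n.
Qed.

Lemma to_circleN z : sqnormc z <> 1 -> circle_val (to_circle z) = 1.
Proof.
move=> z1; rewrite [LHS]val_insubd ifF//; apply/negP.
move=> /eqP/(congr1 (fun z => complex.Re z ^+ 2)); rewrite -[X in _ = X]/(1 ^+ 2).
by rewrite -[X in X = _]/(Normc.normc z ^+ 2) -sqnormcE expr1n.
Qed.

Lemma measurable_to_circle (F : X -> R[i]) : measurable_cfun F ->
  measurable_fun setT (fun x => to_circle (F x)).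
Proof.
move=> mF; have mE : measurable_fun setT (fun x => sqnormc (F x) == 1).
  by apply: measurable_fun_eqr => //; exact: measurable_sqnormc.
apply/measurable_fun_circleP; split.
  rewrite (_ : (fun _ => _) =
      fun x => if sqnormc (F x) == 1 then complex.Re (F x) else 1).
    by apply: measurable_fun_ifT => //; exact: mF.1.
  apply/funext => x; case: ifPn => [/eqP/to_circleE ->//|/eqP/to_circleN ->//].
rewrite (_ : (fun _ => _) =
    fun x => if sqnormc (F x) == 1 then complex.Im (F x) else 0).
  by apply: measurable_fun_ifT => //; exact: mF.2.
apply/funext => x; case: ifPn => [/eqP/to_circleE ->//|/eqP/to_circleN ->//].
Qed.

Lemma mdist_circle_sqr (z w : circle R) :
  mdist z w ^+ 2 = sqnormc (circle_val z - circle_val w).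
Proof. by rewrite mdist_circleE sqnormcE. Qed.

Lemma sqnormc_circle (z : circle R) : sqnormc (circle_val z) = 1.
Proof.
by rewrite sqnormcE; have /(congr1 (@complex.Re R)) := norm_circle z => /= ->;
  rewrite expr1n.
Qed.

(** The two parts converge almost everywhere by [fast_cvg_ae]; the modulus 1 passes to the limit,
    and almost everywhere convergence gives back convergence in measure. *)
Lemma L0_fast_cvg (w : nat -> L0_circle mu) :
  (forall k, L0_ball (w k) (2^-1 ^+ k) (w k.+1)) ->
  exists f, forall e : R, 0 < e -> exists N, forall n, (N <= n)%N -> L0_ball f e (w n).
Proof.
move=> wk; have mw k := (measurable_fun_circleP _).1 (L0_measurable (w k)).
have part (p : R[i] -> R) : (forall u v, p u - p v = p (u - v)) ->
    (forall u, `|p u| <= Normc.normc u) ->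
    (forall k, measurable_fun setT (fun t => p (repr (w k) t))) ->
    exists2 F : X -> R, measurable_fun setT F &
      \forall t \ae mu, (fun k => p (repr (w k) t)) @ \oo --> F t.
  move=> pB ple mp; apply: fast_cvg_ae => // k.
  apply: le_trans (ltW (wk k)); rewrite le_measure ?inE//.
  - rewrite (_ : [set x | _] =
        (fun t => `|p (repr (w k.+1) t) - p (repr (w k) t)|) @^-1` `[2^-1 ^+ k, +oo[).
      rewrite -[X in measurable X]setTI; apply: measurableT_comp => //.
      exact: measurable_funB.
    by apply/seteqP; split => t /=; rewrite in_itv/= andbT.
  - exact: measurable_circle_mdist_ge.
  - move=> t /= kt; rewrite metric_sym mdist_circleE; apply: le_trans (ple _).
    by rewrite -pB.
have [Fr mFr wFr] := part (@complex.Re R) (fun u v => esym (raddfB _ u v))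
  (@Re_le_normc R) (fun k => (mw k).1).
have [Fi mFi wFi] := part (@complex.Im R) (fun u v => esym (raddfB _ u v))
  (@Im_le_normc R) (fun k => (mw k).2).
pose F t := (Fr t +i* Fi t)%C.
have mF : measurable_cfun F by [].
have mf := measurable_to_circle mF.
pose f := L0_class mu (circle_mfun mf).
have cvg0 : \forall t \ae mu,
    (fun k => mdist (to_circle (F t)) (repr (w k) t) ^+ 2) @ \oo --> (0 : R).
  apply: filterS2 wFr wFi => t ar ai.
  have F1 : sqnormc (F t) = 1.
    have := sqnormc_cvg (w := 0 : R[i]) ar ai; rewrite subr0.
    under eq_fun do rewrite subr0 sqnormc_circle.
    by move/cvg_lim => <-//; rewrite lim_cst.
  under eq_fun do rewrite metric_sym mdist_circle_sqr to_circleE//.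
  have := sqnormc_cvg (w := F t) ar ai; rewrite subrr.
  by rewrite (_ : sqnormc 0 = 0)// /sqnormc/= expr0n/= addr0.
exists f => e e0.
have [N NP] := ae_cvg0_in_measure
  (fun n => measurable_funX 2 (measurable_circle_mdist (circle_mfun mf) (repr (w n))))
  cvg0 (exprn_gt0 2 e0) e0.
exists N => n /NP wn; apply/L0_ball_sym/L0_ball_class.
rewrite (_ : [set x | _] = [set x | e ^+ 2 <= mdist (to_circle (F x)) (repr (w n) x) ^+ 2])//.
apply/seteqP; split => x /=; rewrite metric_sym ler_pXn2r// nnegrE ?mdist_ge0//;
  exact: ltW.
Qed.

Lemma ky_fan_complete : complete_metric L0_ky_fan.
Proof.
move=> u uc.
have {}uc e : 0 < e -> exists N, forall n m, (N <= n)%N -> (N <= m)%N ->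
    L0_ball (u n : L0_circle mu) e (u m).
  move=> e0; have /cauchy_ballP/(_ _ e0) := uc.
  rewrite near_simpl => -[[P Q] [[N1 _ N1P] [N2 _ N2Q]] /= PQ].
  exists (maxn N1 N2) => n m; rewrite !geq_max => /andP[n1 n2] /andP[m1 m2].
  apply: ky_fan_lt; have := PQ (n, m) (conj (N1P _ n1) (N2Q _ m2)).
  by rewrite /= ballEmdist.
have /choice[phi phiP] : forall k : nat, exists N, forall n m, (N <= n)%N -> (N <= m)%N ->
    L0_ball (u n : L0_circle mu) (2^-1 ^+ k) (u m).
  by move=> k; apply: uc; rewrite exprn_gt0.
(* Partial sums produce increasing indices that dominate [phi]. *)
pose psi k := (\sum_(i < k.+1) (phi i).+1)%N.
have psiS k : psi k.+1 = (psi k + (phi k.+1).+1)%N by rewrite /psi big_ord_recr.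
have phi_psi k : (phi k <= psi k)%N.
  case: k => [|k]; first by rewrite /psi big_ord1.
  by rewrite psiS (leq_trans (leqnSn _))// leq_addl.
have psi_ge k : (k <= psi k)%N.
  by elim: k => // k IHk; rewrite psiS addnS ltnS (leq_trans IHk)// leq_addr.
have [f fP] : exists f, forall e : R, 0 < e ->
    exists N, forall n, (N <= n)%N -> L0_ball f e (u (psi n)).
  apply: L0_fast_cvg => k; apply: phiP; first exact: phi_psi.
  by rewrite psiS (leq_trans (phi_psi k))// leq_addr.
exists f; apply/cvg_ballP => e e0.
(* Two steps of e/4 stay strictly below [e] after the non-strict [ky_fan_le]. *)
have e40 : 0 < e / 4 by rewrite divr_gt0.
have [N1 N1P] := fP _ e40; have [N2 N2P] := uc _ e40.
exists N2 => // n /= N2n; rewrite ballEmdist/=.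
have : L0_ball f (e / 4 + e / 4) (u n).
  apply: (@L0_ball_triangle _ _ _ _ _ (u (psi (maxn N1 N2)))).
    by apply: N1P; exact: leq_maxl.
  by apply: N2P => //; rewrite (leq_trans (leq_maxr N1 N2)).
by move=> /ky_fan_le/le_lt_trans; apply; lra.
Qed.

End ky_fan.

Lemma L0_polish (R : realType) d (X : measurableType d) (mu : probability X R) :
  standard_borel R X -> polish_space R (L0_circle mu).
Proof.
move=> /standard_borel_generators[B [mB gB sB]].
exists (L0_ky_fan mu), id, id; split; first split => //.
- exact: continuous_to_ky_fan.
- exact: continuous_from_ky_fan.
split; first exact: ky_fan_complete.
have [z zdense] := circle_dense_seq R.
exists (\bigcup_n range (fun phi : {ffun {ffun 'I_n -> bool} -> nat} =>
    L0_class mu (circle_simple mB z phi) : L0_ky_fan mu)).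
  apply: bigcup_countable => // n _; exact: (card_le_trans (card_image_le _ _) (countableP _)).
move=> O [f Of] oO.
have /nbhs_ballP[e /= e0 eO] : nbhs (f : L0_ky_fan mu) O.
  by move: oO; rewrite openE => /(_ f Of).
have e20 : 0 < e / 2 by rewrite divr_gt0.
have [n [phi fphi]] := L0_simple_dense mB gB zdense f e20.
exists (L0_class mu (circle_simple mB z phi)); split; last by exists n => //; exists phi.
apply: eO; rewrite ballEmdist/=; apply: le_lt_trans (ky_fan_le fphi) _.
by rewrite ltr_pdivrMr// ltr_pMr//; lra.
Qed.

(** * Bounded orbits *)

Section bounded_orbits.
Context d (X : measurableType d) (R : realType) (mu : probability X R).
Variable B : nat -> set X.
Hypothesis mB : forall n, measurable (B n).
Implicit Types f g : L0_circle mu.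

Lemma L0_ball1_class (h : {mfun X >-> circle R}) (e : R) :
  (mu [set x | (e <= mdist (1%g : circle R) (h x))%R] < e%:E)%E ->
  L0_ball (1%g : L0_circle mu) e (L0_class mu h).
Proof.
move=> he; apply/L0_ball_class; move: he; congr (_ < _)%E; apply: measure_ae_eq.
- exact: (measurable_circle_mdist_ge (mfun_circle_one X R) h).
- exact: measurable_circle_mdist_ge.
- by apply: filterS (L0_oneE mu) => x /= ->.
Qed.

Lemma measurable_restrict_codes f n (s : seq {ffun 'I_n -> bool}) :
  measurable_fun setT (fun x => if code B n x \in s then repr f x else 1%g).
Proof.
apply: measurable_fun_ifT.
- exact: (measurable_fun_code_invariant mB (code_invariant_comp (fun a => a \in s))).
- exact: (L0_measurable f).
- exact: measurable_cst.
Qed.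

(** A list of codes, so that f can be taken apart atom by atom by induction on [enum]. *)
Definition restrict_codes f n (s : seq {ffun 'I_n -> bool}) : L0_circle mu :=
  L0_class mu (circle_mfun (measurable_restrict_codes f s)).

Lemma restrict_codesE f n (s : seq {ffun 'I_n -> bool}) : \forall x \ae mu,
  repr (restrict_codes f s) x = if code B n x \in s then repr f x else 1%g.
Proof.
by apply: filterS (L0_classP mu (circle_mfun (measurable_restrict_codes f s))) => x; exact.
Qed.

Lemma restrict_codes_enum f n : restrict_codes f (enum {: {ffun 'I_n -> bool}}) = f.
Proof.
apply: L0_eqP; apply: filterS (restrict_codesE f (enum {: {ffun 'I_n -> bool}})) => x ->.
by rewrite mem_enum.
Qed.

Lemma restrict_codes_nil f n : restrict_codes f ([::] : seq {ffun 'I_n -> bool}) = 1%g.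
Proof.
apply: L0_eqP; apply: filterS2 (restrict_codesE f ([::] : seq {ffun 'I_n -> bool}))
  (L0_oneE mu) => x ->.
by move=> ->.
Qed.

(** If [b] were in [s], the product would be the square of f on that atom. *)
Lemma restrict_codes_cons f n (b : {ffun 'I_n -> bool}) (s : seq {ffun 'I_n -> bool}) : b \notin s ->
  restrict_codes f (b :: s) = (restrict_codes f [:: b] * restrict_codes f s)%g.
Proof.
move=> bs; apply: L0_eqP; near=> x.
rewrite (near (L0_mulE (restrict_codes f [:: b]) (restrict_codes f s)) x)//.
rewrite (near (restrict_codesE f (b :: s)) x)// (near (restrict_codesE f [:: b]) x)//.
rewrite (near (restrict_codesE f s) x)// inE mem_seq1.
case: eqVneq => [->|_] /=; first by rewrite (negbTE bs) mulg1.
by rewrite mul1g.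
Unshelve. all: by end_near. Qed.

Lemma restrict_codes1_small f n (b : {ffun 'I_n -> bool}) (e : R) :
  (forall x, (mu [set y | code B n y = code B n x] < e%:E)%E) -> 0 < e ->
  L0_ball (1%g : L0_circle mu) e (restrict_codes f [:: b]).
Proof.
move=> small e0; apply: L0_ball1_class.
apply: (@le_lt_trans _ _ (mu [set y | code B n y = b])).
  rewrite le_measure ?inE//.
  - exact: (measurable_circle_mdist_ge (mfun_circle_one X R)).
  - exact: measurable_code.
  - move=> x /=; rewrite mem_seq1; case: eqVneq => // _.
    by rewrite mdistxx leNgt e0.
(* The hypothesis only speaks of atoms of points; the fibre of any other code is empty. *)
have [[x <-]|nx] := pselect (exists x, code B n x = b); first exact: small.
rewrite (_ : [set _ | _] = set0) ?measure0 ?lte_fin//.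
by apply/seteqP; split => // y /= yb; apply: nx; exists y.
Qed.

End bounded_orbits.

Lemma L0_property_OB (R : realType) d (X : measurableType d) (mu : probability X R) :
  standard_borel R X -> diffuse mu -> property_OB R (L0_circle mu).
Proof.
move=> /standard_borel_generators[B [mB gB sB]] diff M a [a1 aM aI] ca x.
have [e e0 small_move] : exists2 e : R, 0 < e &
    forall g, L0_ball (1%g : L0_circle mu) e g -> mdist (a g x) x < 1.
  have : nbhs ((1%g : L0_circle mu), x) [set p | mdist (a p.1 p.2) x < 1].
    have ca1 : (fun p : L0_circle mu * M => a p.1 p.2) @ ((1%g : L0_circle mu), x) -->
        a 1%g x := ca (1%g, x).
    rewrite a1 in ca1; have /cvg_ballP/(_ 1 ltr01) := ca1.
    by apply: filterS => p; rewrite ballEmdist/= metric_sym.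
  move=> [[P Q] /= [/nbhs_ballP[e /= e0 eP] Qx] PQ].
  exists e => // g eg; apply: (PQ (g, x)); split; first exact: eP.
  exact: nbhs_singleton Qx.
have [n small] := small_atoms mB sB diff e0.
pose C : R := #|{: {ffun 'I_n -> bool}}|%:R.
have bound f : mdist (a f x) x <= C.
  rewrite -{1}(restrict_codes_enum mB f n) /C cardE.
  elim: (enum _) (enum_uniq {: {ffun 'I_n -> bool}}) => [_|b s IHs /= /andP[bs us]].
    by rewrite restrict_codes_nil a1 mdistxx.
  rewrite restrict_codes_cons// aM.
  (* The factor at [b] acts isometrically, so it cancels from the first distance, leaving the
     induction hypothesis; the second distance is below 1. *)
  apply: le_trans (metric_triangle _ (a (restrict_codes mB f [:: b]) x) _) _.
  rewrite aI -natr1 lerD ?IHs// ltW// small_move//.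
  exact: restrict_codes1_small.
exists (C + C) => g h; apply: le_trans (metric_triangle _ x _) _.
by rewrite lerD// metric_sym.
Qed.

(** * The off-diagonal representation *)

Section off_diagonal_representation.
Context d (X : measurableType d) (R : realType) (mu : probability X R).
Implicit Types f g h : L0_circle mu.

Definition product_probability : probability (X * X)%type R := (mu \x mu)%E.
Local Notation nu := product_probability.
Local Notation H := (L2 nu).

Lemma product_probability_fst (S : set X) : measurable S -> nu (S `*` setT) = mu S.
Proof.
by move=> mS; rewrite [LHS]product_measure1E// [X in (_ * X)%E]probability_setT mule1.
Qed.

Lemma product_probability_snd (S : set X) : measurable S -> nu (setT `*` S) = mu S.
Proof.
by move=> mS; rewrite [LHS]product_measure1E// [X in (X * _)%E]probability_setT mul1e.
Qed.

Lemma ae_fst (P : X -> Prop) : (\forall x \ae mu, P x) -> \forall p \ae nu, P p.1.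
Proof.
move=> [N [mN N0 NP]]; exists (N `*` setT); split.
- exact: measurableX.
- by rewrite product_probability_fst.
- by move=> p /= nP; split=> //; exact: NP.
Qed.

Lemma ae_snd (P : X -> Prop) : (\forall x \ae mu, P x) -> \forall p \ae nu, P p.2.
Proof.
move=> [N [mN N0 NP]]; exists (setT `*` N); split.
- exact: measurableX.
- by rewrite product_probability_snd.
- by move=> p /= nP; split=> //; exact: NP.
Qed.

Definition multiplier f (p : X * X) : R[i] :=
  circle_val (repr f p.1) * conjc (circle_val (repr f p.2)).

Lemma measurable_multiplier f : measurable_cfun (multiplier f).
Proof.
have [fr fi] := (measurable_fun_circleP _).1 (L0_measurable f).
apply: measurable_cfunM; first split.
- exact: measurableT_comp fr measurable_fst.
- exact: measurableT_comp fi measurable_fst.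
apply: measurable_cfun_conj; split.
- exact: measurableT_comp fr measurable_snd.
- exact: measurableT_comp fi measurable_snd.
Qed.

Lemma sqnormcJ (z : R[i]) : sqnormc (conjc z) = sqnormc z.
Proof. by rewrite /sqnormc !ReImE sqrrN. Qed.

Lemma sqnormc_multiplier f p : sqnormc (multiplier f p) = 1.
Proof. by rewrite sqnormcM sqnormcJ !sqnormc_circle mulr1. Qed.

Lemma square_integrable_multiplier f (x : H) :
  square_integrable nu (fun p => multiplier f p * x p).
Proof.
apply: (square_integrableM (M := 1) (L2_square_integrable x)).
  exact: measurable_multiplier.
by move=> p; rewrite sqnormc_multiplier.
Qed.

Definition off_diag_rep f (x : H) : H := L2_class nu (fun p => multiplier f p * x p).

Lemma off_diag_repE f x : \forall p \ae nu, off_diag_rep f x p = multiplier f p * x p.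
Proof. exact/L2_classE/square_integrable_multiplier. Qed.

Lemma multiplier_one : \forall p \ae nu, multiplier (1%g : L0_circle mu) p = 1.
Proof.
apply: filterS2 (ae_fst (L0_oneE mu)) (ae_snd (L0_oneE mu)) => p /= p1 p2.
by rewrite /multiplier p1 p2 /= mul1r; apply: complexP => /=; rewrite ?oppr0.
Qed.

Lemma multiplierM f g : \forall p \ae nu,
  multiplier (f * g)%g p = multiplier f p * multiplier g p.
Proof.
apply: filterS2 (ae_fst (L0_mulE f g)) (ae_snd (L0_mulE f g)) => p /= p1 p2.
rewrite /multiplier p1 p2 !circle_valM.
by apply: complexP; rewrite !ReImE; ring.
Qed.

Lemma off_diag_rep_linear f : linear (off_diag_rep f).
Proof.
move=> a x y; apply: L2_ae_eq; near=> p.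
rewrite (near (off_diag_repE f (a *: x + y)) p)//.
rewrite (near (L2_addE (a *: x) y) p)// (near (L2_scaleE a x) p)//.
rewrite (near (L2_addE (a *: off_diag_rep f x) (off_diag_rep f y)) p)//.
rewrite (near (L2_scaleE a (off_diag_rep f x)) p)//.
rewrite (near (off_diag_repE f x) p)// (near (off_diag_repE f y) p)//.
by rewrite mulrDr mulrCA.
Unshelve. all: by end_near. Qed.

Lemma off_diag_rep_dot f x y :
  L2_dot (off_diag_rep f x) (off_diag_rep f y) = L2_dot x y.
Proof.
apply: cintegral_ae.
- by apply: measurable_cfunM; [|apply: measurable_cfun_conj]; exact: L2_measurable.
- by apply: measurable_cfunM; [|apply: measurable_cfun_conj]; exact: L2_measurable.
- apply: filterS2 (off_diag_repE f x) (off_diag_repE f y) => p -> ->.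
  rewrite rmorphM mulrACA (_ : _ * (multiplier f p)^*%C = 1) ?mul1r//.
  have := sqnormc_multiplier f p; rewrite /sqnormc; move: (multiplier f p) => m m1.
  apply: complexP; first by rewrite !ReImE -[RHS]m1; ring.
  by rewrite !ReImE -[RHS]/(0 : R); ring.
Qed.

Lemma off_diag_rep_one x : off_diag_rep 1%g x = x.
Proof.
apply: L2_ae_eq; apply: filterS2 (off_diag_repE 1%g x) multiplier_one => p -> ->.
by rewrite mul1r.
Qed.

Lemma off_diag_repM f g x : off_diag_rep (f * g)%g x = off_diag_rep f (off_diag_rep g x).
Proof.
apply: L2_ae_eq; near=> p.
rewrite (near (off_diag_repE (f * g)%g x) p)// (near (multiplierM f g) p)//.
rewrite (near (off_diag_repE f (off_diag_rep g x)) p)//.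
by rewrite (near (off_diag_repE g x) p)// mulrA.
Unshelve. all: by end_near. Qed.

Lemma off_diag_rep_unitary :
  @unitary_representation R (L0_circle mu) H off_diag_rep.
Proof.
split.
- exact: off_diag_rep_linear.
- exact: off_diag_rep_dot.
- exact: off_diag_rep_one.
- exact: off_diag_repM.
Qed.

Definition cross (S : set X) : set (X * X) := (S `*` setT) `|` (setT `*` S).

Lemma measurable_cross S : measurable S -> measurable (cross S).
Proof. by move=> mS; apply: measurableU; exact: measurableX. Qed.

Definition apart f g (r : R) := [set x | r <= mdist (repr f x) (repr g x)].

Lemma measurable_apart f g r : measurable (apart f g r).
Proof. exact: measurable_circle_mdist_ge. Qed.

Lemma sqnormc_multiplierB_le f g p :
  sqnormc (multiplier f p - multiplier g p) <=
  2 * mdist (repr f p.1) (repr g p.1) ^+ 2 + 2 * mdist (repr f p.2) (repr g p.2) ^+ 2.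
Proof.
rewrite !mdist_circle_sqr /multiplier.
set a := circle_val (repr f p.1); set b := circle_val (repr f p.2).
set a' := circle_val (repr g p.1); set b' := circle_val (repr g p.2).
have -> : a * conjc b - a' * conjc b' = (a - a') * conjc b + a' * conjc (b - b').
  by rewrite rmorphB; ring.
rewrite (le_trans (sqnormcD_le _ _))// !sqnormcM !sqnormcJ.
by rewrite !sqnormc_circle mulr1 mul1r.
Qed.

(** Off the cross both coordinate distances are below [r], contributing 2r^2 each; on it the two
    multipliers have modulus 1, contributing 2 each. *)
Lemma sqnormc_multiplierB_apart f g p (r : R) : 0 <= r ->
  sqnormc (multiplier f p - multiplier g p) <=
  4 * r ^+ 2 + 4 * \1_(cross (apart f g r)) p.
Proof.
move=> r0; have [pT|pT] := pselect (cross (apart f g r) p).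
  rewrite indicE mem_set// mulr1 ler_wpDl ?mulr_ge0 ?exprn_ge0//.
  rewrite (le_trans (sqnormcD_le _ _))// sqnormcN !sqnormc_multiplier; lra.
rewrite indicE memNset// mulr0 addr0 (le_trans (sqnormc_multiplierB_le _ _ _))//.
have lt1 : mdist (repr f p.1) (repr g p.1) ^+ 2 <= r ^+ 2.
  rewrite ler_pXn2r ?nnegrE ?mdist_ge0//; apply/ltW; rewrite ltNge; apply/negP => h.
  by apply: pT; left.
have lt2 : mdist (repr f p.2) (repr g p.2) ^+ 2 <= r ^+ 2.
  rewrite ler_pXn2r ?nnegrE ?mdist_ge0//; apply/ltW; rewrite ltNge; apply/negP => h.
  by apply: pT; right.
lra.
Qed.

(** The common estimate behind strong continuity and almost invariance: it remains to bound the mass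
    of |x|^2 over the cross, by absolute continuity for a fixed vector, by the marginals for the
    near-diagonal ones. *)
Lemma off_diag_rep_dist f g (x : H) (r : R) : 0 <= r ->
  ((L2_sqnorm (off_diag_rep f x - off_diag_rep g x))%:E <=
   (4 * r ^+ 2 * L2_sqnorm x)%:E +
   4%:E * \int[nu]_(p in cross (apart f g r)) (sqnormc (x p))%:E)%E.
Proof.
move=> r0; set T := cross _.
have mT : measurable T by apply: measurable_cross; exact: measurable_apart.
have mx : measurable_fun setT (fun p => (sqnormc (x p))%:E).
  by apply/measurable_EFinP; exact/measurable_sqnormc/L2_measurable.
rewrite L2_sqnormBE.
pose D p := (multiplier f p - multiplier g p) * x p.
have mD : measurable_cfun D.
  rewrite (_ : D = fun p => multiplier f p * x p - multiplier g p * x p).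
    by case: (square_integrableB (square_integrable_multiplier f x)
      (square_integrable_multiplier g x)).
  by apply/funext => p; rewrite /D mulrBl.
rewrite (@integral_sqnormc_ae _ _ _ _ _ D)//; last 2 first.
- by case: (square_integrableB (L2_square_integrable (off_diag_rep f x))
    (L2_square_integrable (off_diag_rep g x))).
- apply: filterS2 (off_diag_repE f x) (off_diag_repE g x) => p -> ->.
  by rewrite /D mulrBl.
rewrite [X in (_ <= _ + _ * X)%E]integral_mkcond EFinM L2_sqnormE.
have mTx : measurable_fun setT ((fun p => (sqnormc (x p))%:E) \_ T).
  by apply/(measurable_restrictT _ mT); exact: measurable_funTS.
have Tx0 p : (0 <= ((fun p => (sqnormc (x p))%:E) \_ T) p)%E.
  by rewrite patchE; case: ifPn => // _; rewrite lee_fin sqnormc_ge0.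
have r20 : 0 <= 4 * r ^+ 2 by rewrite mulr_ge0// exprn_ge0.
rewrite -[X in (_ <= X + _)%E]ge0_integralZl_EFin//; last first.
  by move=> p _; rewrite lee_fin sqnormc_ge0.
rewrite -[X in (_ <= _ + X)%E]ge0_integralZl_EFin//.
rewrite -ge0_integralD//; first last.
- exact: measurable_funeM.
- by move=> p _; rewrite mule_ge0.
- exact: measurable_funeM.
- by move=> p _; rewrite mule_ge0// lee_fin ?sqnormc_ge0.
apply: ge0_le_integral => //.
- by move=> p _; rewrite lee_fin sqnormc_ge0.
- exact/measurable_EFinP/measurable_sqnormc.
- by apply: emeasurable_funD; exact: measurable_funeM.
move=> p _; rewrite (_ : ((_ \_ T) p) = (\1_T p * sqnormc (x p))%:E); last first.
  by rewrite patchE indicE; case: ifPn => _; rewrite ?mul1r ?mul0r.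
rewrite -!EFinM -EFinD lee_fin /D sqnormcM (mulrA 4 (\1_T p)) -mulrDl ler_wpM2r ?sqnormc_ge0//.
exact: sqnormc_multiplierB_apart.
Qed.

Lemma product_probability_cross_le (S : set X) : measurable S -> (nu (cross S) <= 2%:E * mu S)%E.
Proof.
move=> mS; apply: (@le_trans _ _ (nu (S `*` setT) + nu (setT `*` S))%E).
  by apply: measureU2; exact: measurableX.
rewrite product_probability_fst// product_probability_snd//.
by rewrite -[2%:E]/((1 + 1)%:E) EFinD ge0_muleDl// mul1e.
Qed.

Lemma off_diag_rep_continuous :
  @strongly_continuous R (L0_circle mu) H off_diag_rep.
Proof.
move=> x f; apply: (@cvg_ballP _ _ _ _ (nbhs_filter f) _ _).2 => e /complex_gt0[-> ].
set e' := complex.Re e => e0; pose N := L2_sqnorm x.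
have N0 : 0 <= N by exact: L2_sqnorm_ge0.
have [_ ix] := L2_square_integrable x.
have e8 : 0 < e' ^+ 2 / 8 by rewrite divr_gt0// exprn_gt0.
have [r [r0 rP]] := integral_normr_continuous ix e8.
(* The bound 1 gives s^2 <= s; r/2 makes the cross lighter than [r]; the last makes 4 s N at most
   half of e'^2. The integral over the cross takes the other half, and N + 1 avoids dividing by
   0. *)
pose s := Num.min 1 (Num.min (r / 2) (e' ^+ 2 / (8 * (N + 1)))).
have N1 : 0 < N + 1 by lra.
have s0 : 0 < s by rewrite /s !lt_min ltr01 !divr_gt0 ?exprn_gt0 ?mulr_gt0.
apply/nbhs_ballP; exists s => //= g fg.
apply/L2_ballP; rewrite /L2_norm -[ltRHS]ger0_norm ?ltW// -sqrtr_sqr ltr_sqrt ?exprn_gt0//.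
rewrite -lte_fin; apply: le_lt_trans (off_diag_rep_dist f g x (ltW s0)) _.
have mS := measurable_apart f g s.
have nS : (nu (cross (apart f g s)) < r%:E)%E.
  apply: le_lt_trans (product_probability_cross_le mS) _.
  apply: (@lt_le_trans _ _ (2%:E * s%:E)%E).
    by rewrite lte_pmul2l//; exact: fg.
  rewrite -EFinM lee_fin mulrC -ler_pdivlMr//.
  by rewrite /s !ge_min lexx orbT.
have := rP _ (measurable_cross mS) nS.
under eq_Rintegral do rewrite ger0_norm ?sqnormc_ge0//.
have fin : (\int[nu]_(p in cross (apart f g s)) (sqnormc (x p))%:E)%E \is a fin_num.
  apply: integrable_fin_num; first exact: measurable_cross.
  exact: integrableS measurableT (measurable_cross mS) _ ix.
rewrite /Rintegral => lte8.
rewrite -(fineK fin) -EFinM -EFinD lte_fin -/N.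
have sN : s * N <= e' ^+ 2 / 8.
  apply: (@le_trans _ _ (e' ^+ 2 / (8 * (N + 1)) * (N + 1))).
    apply: ler_pM => //; [exact: ltW| |lra].
    by rewrite /s !ge_min lexx !orbT.
  by rewrite le_eqVlt; apply/orP; left; apply/eqP; field; lra.
have s1 : s <= 1 by rewrite /s ge_min lexx.
have ss : s ^+ 2 <= s by rewrite expr2 ler_piMr// ltW.
have := ler_wpM2r N0 ss; nra.
Qed.

End off_diagonal_representation.

(** * Near-diagonal vectors: almost invariant, with no invariant unit vector *)

Section almost_invariance.
Context d (X : measurableType d) (R : realType) (mu : probability X R).
Variable B : nat -> set X.
Hypothesis mB : forall n, measurable (B n).
Local Notation nu := (product_probability mu).
Local Notation H := (L2 nu).

Definition atom_mass n (a : {ffun 'I_n -> bool}) : R := fine (mu [set y | code B n y = a]).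

Lemma atom_massE n a : (@atom_mass n a)%:E = mu [set y | code B n y = a].
Proof. by rewrite fineK// fin_num_measure//; exact: measurable_code. Qed.

(* Zero on null atoms, where [(atom_mass a)^-1 = 0]. *)
Definition atom_weight n (a b : {ffun 'I_n -> bool}) : R :=
  if a == b then (atom_mass a)^-1 else 0.

Lemma atom_weight_ge0 n (a b : {ffun 'I_n -> bool}) : 0 <= atom_weight a b.
Proof. by rewrite /atom_weight; case: ifP => // _; rewrite invr_ge0 fine_ge0. Qed.

Lemma atom_weightC n (a b : {ffun 'I_n -> bool}) : atom_weight a b = atom_weight b a.
Proof. by rewrite /atom_weight eq_sym; case: eqVneq => // ->. Qed.

Lemma measurable_fun_code2 n (F : {ffun 'I_n -> bool} -> {ffun 'I_n -> bool} -> R) :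
  measurable_fun setT (fun p : X * X => F (code B n p.1) (code B n p.2)).
Proof.
move=> _ C mC; rewrite setTI.
pose A (a : {ffun 'I_n -> bool} * {ffun 'I_n -> bool}) := `[< C (F a.1 a.2) >].
rewrite (_ : _ @^-1` _ = [set p | A (code B n p.1, code B n p.2)]).
  exact: measurable_code2.
by apply/seteqP; split => p /= /asboolP.
Qed.

Lemma integral_atom_weight n x :
  (\int[mu]_y (atom_weight (code B n x) (code B n y))%:E =
   (atom_mass (code B n x) != 0)%:R%:E)%E.
Proof.
have -> : (fun y => (atom_weight (code B n x) (code B n y))%:E) =
    (fun y => ((atom_mass (code B n x))^-1)%:E *
      (\1_[set y | code B n y = code B n x] y)%:E)%E.
  apply/funext => y; rewrite -EFinM /atom_weight indicE eq_sym.
  by case: eqVneq => [yx|/eqP yx]; [rewrite mem_set// mulr1|rewrite memNset// mulr0].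
have mA : measurable [set y | code B n y = code B n x] by exact: measurable_code.
rewrite ge0_integralZl_EFin//; first last.
- by rewrite invr_ge0 fine_ge0.
- by apply/measurable_EFinP; exact: measurable_indic.
rewrite integral_indic// setIT.
rewrite [X in (_ * X)%E](_ : _ = (atom_mass (code B n x))%:E) -?EFinM; last first.
  exact/esym/atom_massE.
by case: eqVneq => [->|m0]; rewrite ?mulr0// mulVf.
Qed.

(** There are finitely many codes, so the null atoms together are null. *)
Lemma ae_atom_mass_neq0 n : \forall x \ae mu, atom_mass (code B n x) != 0.
Proof.
pose N := [set x | (fun a : {ffun 'I_n -> bool} => atom_mass a == 0) (code B n x)].
exists N; split=> [||x /= /negP/negPn//].
  exact: (measurable_code_pred mB (fun a : {ffun 'I_n -> bool} => atom_mass a == 0)).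
rewrite (_ : N = \bigcup_(a in [set a : {ffun 'I_n -> bool} | atom_mass a == 0])
    [set x | code B n x = a]); last first.
  apply/seteqP; split => [x Nx|x [a a0 /= xa]]; first by exists (code B n x).
  by rewrite /N /= xa.
apply: measure_negligible.
  apply: fin_bigcup_measurable => [|a _]; first exact: finite_finset.
  exact: measurable_code.
rewrite -bigsetU_fset_set; last exact: finite_finset.
rewrite big_seq;
  elim/big_ind: _ => [||a]; [exact: negligible_set0|exact: negligibleU|].
rewrite in_fset_set; last exact: finite_finset.
rewrite inE => /= /eqP a0; apply/negligibleP; first exact: measurable_code.
by rewrite -[LHS]/(mu _) -atom_massE a0.
Qed.

Lemma measurable_atom_weight n :
  measurable_fun setT (fun p : X * X => (atom_weight (code B n p.1) (code B n p.2))%:E).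
Proof.
by apply/measurable_EFinP; exact: (measurable_fun_code2 (@atom_weight n)).
Qed.

(** Tonelli: the inner integral is the indicator of S at every point outside the null atoms. *)
Lemma atom_weight_marginal_fst n (S : set X) : measurable S ->
  (\int[nu]_(p in S `*` setT) (atom_weight (code B n p.1) (code B n p.2))%:E = mu S)%E.
Proof.
move=> mS; rewrite integral_mkcond.
have mST : measurable (S `*` [set: X]) by exact: measurableX.
rewrite [LHS]fubini_tonelli1; first last.
- by move=> p; rewrite patchE; case: ifP => // _; rewrite lee_fin atom_weight_ge0.
- apply/(measurable_restrictT _ mST); apply: measurable_funTS.
  exact: measurable_atom_weight.
rewrite -[in RHS](setIT S) -integral_indic//.
apply: ge0_ae_eq_integral => //.
- apply: measurable_fun_fubini_tonelli_F.
  + apply/(measurable_restrictT _ mST); apply: measurable_funTS.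
    exact: measurable_atom_weight.
  + by move=> p; rewrite patchE; case: ifP => // _; rewrite lee_fin atom_weight_ge0.
- by apply/measurable_EFinP; exact: measurable_indic.
- move=> x _; apply: integral_ge0 => y _.
  by rewrite patchE; case: ifP => // _; rewrite lee_fin atom_weight_ge0.
- apply: filterS (ae_atom_mass_neq0 n) => x x0 _; rewrite /fubini_F indicE.
  have [Sx|nSx] := pselect (S x).
    rewrite mem_set//; have := integral_atom_weight n x; rewrite x0 => <-.
    by apply: eq_integral => y _; rewrite patchE ifT// inE.
  rewrite memNset//= integral0_eq// => y _.
  by rewrite patchE ifF//; apply/negP; rewrite inE => -[].
Qed.

(** The weight is symmetric, so the other order of integration gives the first marginal. *)
Lemma atom_weight_marginal_snd n (S : set X) : measurable S ->
  (\int[nu]_(p in setT `*` S) (atom_weight (code B n p.1) (code B n p.2))%:E = mu S)%E.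
Proof.
move=> mS; rewrite -(atom_weight_marginal_fst n mS).
rewrite [LHS]integral_mkcond [RHS]integral_mkcond.
have mST : measurable (S `*` [set: X]) by exact: measurableX.
have mTS : measurable ([set: X] `*` S) by exact: measurableX.
rewrite [LHS]fubini_tonelli2; first last.
- by move=> p; rewrite patchE; case: ifP => // _; rewrite lee_fin atom_weight_ge0.
- apply/(measurable_restrictT _ mTS); apply: measurable_funTS.
  exact: measurable_atom_weight.
rewrite [RHS]fubini_tonelli1; first last.
- by move=> p; rewrite patchE; case: ifP => // _; rewrite lee_fin atom_weight_ge0.
- apply/(measurable_restrictT _ mST); apply: measurable_funTS.
  exact: measurable_atom_weight.
apply: eq_integral => x _; apply: eq_integral => y _ /=; rewrite !patchE.
have -> : ((y, x) \in [set: X] `*` S) = ((x, y) \in S `*` [set: X]).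
  by apply/idP/idP; rewrite !inE => -[].
by case: ifP => // _; rewrite atom_weightC.
Qed.

(* The squared modulus is a coupling of [mu] with itself carried by the pairs with
   equal [n]-codes: hence a function constant on the atoms fixes the vector, and
   the distance moved by any [f] is controlled by a distance in measure. *)
Definition near_diagonal_fun n (p : X * X) : R[i] :=
  (Num.sqrt (atom_weight (code B n p.1) (code B n p.2)))%:C%C.

Lemma sqnormc_near_diagonal n p :
  sqnormc (near_diagonal_fun n p) = atom_weight (code B n p.1) (code B n p.2).
Proof. by rewrite /sqnormc/= expr0n/= addr0 sqr_sqrtr// atom_weight_ge0. Qed.

Lemma square_integrable_near_diagonal n : square_integrable nu (near_diagonal_fun n).
Proof.
have mf : measurable_cfun (near_diagonal_fun n).
  split; last exact: measurable_cst.
  exact: (measurable_fun_code2 (fun a b => Num.sqrt (@atom_weight n a b))).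
split=> //; apply/integrableP; split.
  by apply/measurable_EFinP; exact: measurable_sqnormc.
under eq_integral do rewrite gee0_abs ?lee_fin ?sqnormc_ge0// sqnormc_near_diagonal.
have := atom_weight_marginal_fst n measurableT; rewrite setXTT => ->.
by rewrite probability_setT ltry.
Qed.

Definition near_diagonal n : H := L2_class nu (near_diagonal_fun n).

Lemma sqnormc_near_diagonal_ae n : \forall p \ae nu,
  sqnormc (near_diagonal n p) = atom_weight (code B n p.1) (code B n p.2).
Proof.
apply: filterS (L2_classE (square_integrable_near_diagonal n)) => p ->.
exact: sqnormc_near_diagonal.
Qed.

Lemma near_diagonal_norm n : `|near_diagonal n| = 1.
Proof.
rewrite L2_normE (_ : L2_sqnorm _ = 1) ?sqrtr1//; apply: EFin_inj.
rewrite L2_sqnormE -(@probability_setT _ _ _ mu) -(atom_weight_marginal_fst n measurableT).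
rewrite setXTT; apply: ge0_ae_eq_integral => //.
- by apply/measurable_EFinP; apply: measurable_sqnormc; exact: L2_measurable.
- exact: measurable_atom_weight.
- by move=> p _; rewrite lee_fin sqnormc_ge0.
- by move=> p _; rewrite lee_fin atom_weight_ge0.
- by apply: filterS (sqnormc_near_diagonal_ae n) => p ->.
Qed.

(** Each strip of the cross has mass mu(S) by a marginal; the bound does not depend on [n]. *)
Lemma near_diagonal_cross_le n (S : set X) : measurable S ->
  (\int[nu]_(p in cross S) (sqnormc (near_diagonal n p))%:E <= 2%:E * mu S)%E.
Proof.
move=> mS; have mST : measurable (S `*` [set: X]) by exact: measurableX.
have mTS : measurable ([set: X] `*` S) by exact: measurableX.
have mC := measurable_cross mS.
have mw := measurable_atom_weight n.
have w0 p : (0 <= (atom_weight (code B n p.1) (code B n p.2))%:E)%E.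
  by rewrite lee_fin atom_weight_ge0.
rewrite (@ge0_ae_eq_integral _ _ _ nu _ _
  (fun p => (atom_weight (code B n p.1) (code B n p.2))%:E))//; first last.
- by apply: filterS (sqnormc_near_diagonal_ae n) => p ->.
- by move=> p _; rewrite lee_fin sqnormc_ge0.
- exact: measurable_funTS.
- apply: measurable_funTS; apply/measurable_EFinP.
  by apply: measurable_sqnormc; exact: L2_measurable.
apply: (@le_trans _ _ (mu S + mu S)%E); last first.
  by rewrite -[2%:E]/((1 + 1)%:E) EFinD ge0_muleDl// mul1e.
rewrite -{1}(atom_weight_marginal_fst n mS) -(atom_weight_marginal_snd n mS).
rewrite [leLHS]integral_mkcond [X in (_ <= X + _)%E]integral_mkcond.
rewrite [X in (_ <= _ + X)%E]integral_mkcond -ge0_integralD//; first last.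
- by apply/(measurable_restrictT _ mTS); exact: measurable_funTS.
- by move=> p _; rewrite patchE; case: ifP.
- by apply/(measurable_restrictT _ mST); exact: measurable_funTS.
- by move=> p _; rewrite patchE; case: ifP.
have rw T p : (0 <= ((fun p => (atom_weight (code B n p.1) (code B n p.2))%:E) \_ T) p)%E.
  by rewrite patchE; case: ifP.
apply: ge0_le_integral => //.
- by apply/(measurable_restrictT _ mC); exact: measurable_funTS.
- apply: emeasurable_funD.
    by apply/(measurable_restrictT _ mST); exact: measurable_funTS.
  by apply/(measurable_restrictT _ mTS); exact: measurable_funTS.
move=> p _; rewrite [leLHS]patchE; case: ifPn; last by move=> _; rewrite adde_ge0.
rewrite inE => -[Sp|Sp].
  by rewrite [X in (_ <= X + _)%E]patchE mem_set// leeDl.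
by rewrite [X in (_ <= _ + X)%E]patchE mem_set// leeDr.
Qed.

Definition code_measurable_class n (f : L0_circle mu) := exists F : X -> circle R,
  code_invariant B n F /\ \forall x \ae mu, repr f x = F x.

Lemma near_diagonal_fixed n f : code_measurable_class n f ->
  off_diag_rep f (near_diagonal n) = near_diagonal n.
Proof.
move=> [F [nF fF]]; apply: L2_ae_eq; near=> p.
rewrite (near (off_diag_repE f (near_diagonal n)) p)//.
have -> : near_diagonal n p = near_diagonal_fun n p.
  by near: p; exact/L2_classE/square_integrable_near_diagonal.
rewrite /multiplier (near (ae_fst fF) p)// (near (ae_snd fF) p)//.
(* For unequal codes the vector vanishes; for equal ones F takes the same value twice and the
   multiplier is 1. *)
rewrite /near_diagonal_fun /atom_weight; case: eqVneq => [/nF ->|_]; last first.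
  by rewrite sqrtr0 mulr0.
rewrite (_ : circle_val _ * _ = 1) ?mul1r//.
have := sqnormc_circle (F p.2); rewrite /sqnormc; move: (circle_val _) => m m1.
apply: complexP; first by rewrite !ReImE -[RHS]m1; ring.
by rewrite !ReImE -[RHS]/(0 : R); ring.
Unshelve. all: by end_near. Qed.

Hypothesis gB : generates_measurable B.

(** The sets [U n] increase with [n], and by density of the simple functions their interiors cover
    K; the largest index of a finite subcover serves for all of K. *)
Lemma compact_near_code_measurable (K : set (L0_circle mu)) (e : R) :
  compact K -> 0 < e ->
  exists n, forall g, K g -> exists2 f, code_measurable_class n f & L0_ball g e f.
Proof.
move=> cK e0; have [z zdense] := circle_dense_seq R.
pose U n := [set g : L0_circle mu | exists2 f, code_measurable_class n f & L0_ball g e f].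
have mono n m : (n <= m)%N -> U n `<=` U m.
  move=> nm g [f [F [nF fF]] gf]; exists f => //; exists F; split=> //.
  exact: code_invariant_le nm nF.
have e20 : 0 < e / 2 by rewrite divr_gt0.
have : K `<=` cover [set: nat] (fun n => (U n)^°).
  move=> g _; have [n [phi gphi]] := L0_simple_dense mB gB zdense g e20.
  exists n => //; apply/nbhs_ballP; exists (e / 2) => //= h gh.
  exists (L0_class mu (circle_simple mB z phi)).
    exists (circle_simple mB z phi); split; first exact: code_invariant_comp.
    by apply: filterS (L0_classP mu (circle_simple mB z phi)) => x; exact.
  by rewrite [e]splitr; apply: L0_ball_triangle gphi; exact: L0_ball_sym.
(* [compact_cover] is stated for pointed topological spaces. *)
pose T : ptopologicalType :=
  HB.pack (L0_circle mu) (isPointed.Build (L0_circle mu) (1%g : L0_circle mu)).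
have ccK : @cover_compact T K by rewrite -compact_cover.
move=> /ccK[n _|D _ KD]; first exact: open_interior.
exists (\max_(i <- finmap.enum_fset D) i)%N => g /KD[n /= nD /interior_subset gn].
by apply: mono gn; exact: (@leq_bigmax_seq _ _ xpredT (fun i => i)).
Qed.

Lemma off_diag_rep_almost_invariant :
  @almost_invariant_vectors R (L0_circle mu) H (@off_diag_rep _ _ _ mu).
Proof.
(* The squared displacement comes out below 4r^2 + 8r <= 12r, at most three quarters of e^2. *)
move=> e K e0 cK; pose r := Num.min 1 (e ^+ 2 / 16).
have r0 : 0 < r by rewrite lt_min ltr01 divr_gt0// exprn_gt0.
have [n nK] := compact_near_code_measurable cK r0.
exists (near_diagonal n); split; first exact: near_diagonal_norm.
(* The vector is replaced by its image under the nearby f that fixes it, so that f and g are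
   compared on the same vector. *)
move=> g /nK[f nf gf]; rewrite -{1}(near_diagonal_fixed nf) L2_normE ltcR.
rewrite -[ltRHS]ger0_norm ?ltW// -sqrtr_sqr ltr_sqrt ?exprn_gt0//.
rewrite -lte_fin.
apply: le_lt_trans (off_diag_rep_dist f g (near_diagonal n) (ltW r0)) _.
have := near_diagonal_norm n; rewrite L2_normE => /(congr1 (@complex.Re R)) /=.
move=> /(congr1 (fun t => t ^+ 2)); rewrite sqr_sqrtr ?L2_sqnorm_ge0// expr1n => ->.
have mS := measurable_apart f g r.
have fS : (mu (apart f g r) < r%:E)%E by exact: L0_ball_sym gf.
apply: (@le_lt_trans _ _ ((4 * r ^+ 2)%:E + 4%:E * (2%:E * mu (apart f g r)))%E).
  by rewrite mulr1 leeD2l// lee_pmul2l//; exact: near_diagonal_cross_le.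
have r1 : r <= 1 by rewrite /r ge_min lexx.
have rr : r ^+ 2 <= r by rewrite expr2 ler_piMr// ltW.
have re : r <= e ^+ 2 / 16 by rewrite /r ge_min lexx orbT.
move: fS; rewrite -(fineK (fin_num_measure mu _ mS)) -!EFinM -EFinD !lte_fin => fS.
lra.
Qed.

Hypothesis sB : separates_points B.
Hypothesis diff : diffuse mu.

Definition sign_fun i (x : X) : circle R :=
  if x \in B i then to_circle (-1 : R[i]) else 1%g.

Lemma measurable_sign_fun i : measurable_fun setT (sign_fun i).
Proof.
apply: (@measurable_fun_code_invariant _ _ B mB _ _ i.+1) => x y /codeP/(_ i (ltnSn i)).
move=> /propext Bxy; rewrite /sign_fun (_ : (x \in B i) = (y \in B i))//.
by apply/idP/idP; rewrite !inE Bxy.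
Qed.

(* The function equal to -1 on [B i] and to 1 elsewhere acts by -1 on the pairs
   separated by [B i], and almost every pair is separated by some [B i]. *)
Lemma off_diag_rep_no_invariant :
  ~ @invariant_unit_vector R (L0_circle mu) H (@off_diag_rep _ _ _ mu).
Proof.
move=> [x [x1 xinv]]; suff x0 : x = 0.
  by move: x1; rewrite x0 normr0 => /eqP; rewrite eq_sym oner_eq0.
pose s i := L0_class mu (circle_mfun (measurable_sign_fun i)).
have sE i : \forall t \ae mu, repr (s i) t = sign_fun i t.
  by apply: filterS (L0_classP mu (circle_mfun (measurable_sign_fun i))) => t; exact.
have opp1 : circle_val (to_circle (-1 : R[i])) = -1.
  by apply: to_circleE; rewrite sqnormcN /sqnormc/= expr1n expr0n/= addr0.
have conj1 : conjc (circle_val (1%g : circle R)) = 1.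
  by rewrite -[circle_val _]/(1 : R[i]) rmorph1.
have conjN1 : conjc (-1 : R[i]) = -1.
  by rewrite rmorphN1.
have eqN0 (w : R[i]) : w = -1 * w -> w = 0.
  by rewrite mulN1r => /eqP; rewrite -subr_eq0 opprK -mulr2n mulrn_eq0/= => /eqP.
have split0 i : \forall p \ae nu, ~ (B i p.1 <-> B i p.2) -> x p = 0.
  have := off_diag_repE (s i) x; rewrite xinv.
  apply: filterS3 (ae_fst (sE i)) (ae_snd (sE i)) => p /= p1 p2 xp nB.
  apply: eqN0; rewrite [LHS]xp /multiplier p1 p2 /sign_fun; congr (_ * _).
  case: (boolP (p.1 \in B i)); case: (boolP (p.2 \in B i)); rewrite ?inE ?notin_setE.
  - by move=> B2 B1; case: nB; split.
  - by rewrite opp1 conj1 mulr1.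
  - by rewrite opp1 conjN1 mul1r.
  - by move=> B2 B1; case: nB; split.
have offdiag : \forall p \ae nu, exists i, ~ (B i p.1 <-> B i p.2).
  exists (\bigcap_n same_code B n); split.
  - by apply: bigcap_measurableType => n _; exact: measurable_same_code.
  - exact: bigcap_same_code0.
  - move=> p /= np n _; apply/codeP => i _.
    by apply: contrapT => nB; apply: np; exists i.
(* There are countably many generators, so one null set serves for all of them. *)
apply: L2_ae_eq; have := ae_foralln split0.
apply: filterS3 offdiag (L2_zeroE nu) => p [i pi] -> xp.
exact: xp pi.
Qed.

End almost_invariance.

Lemma L0_not_property_T (R : realType) d (X : measurableType d) (mu : probability X R) :
  standard_borel R X -> diffuse mu -> ~ property_T R (L0_circle mu).
Proof.
move=> /standard_borel_generators[B [mB gB sB]] diff propT.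
apply: (off_diag_rep_no_invariant mB sB diff).
apply: propT.
- exact: off_diag_rep_unitary.
- exact: off_diag_rep_continuous.
- exact: off_diag_rep_almost_invariant mB gB.
Qed.

Theorem mainTheorem10 (R : realType) (d : measure_display)
    (X : measurableType d) (mu : probability X R)
    (X_standard : standard_borel R X) (mu_diffuse : diffuse mu) :
  [/\ polish_space R (L0_circle mu),
      ~ property_T R (L0_circle mu) &
      property_OB R (L0_circle mu)].
Proof.
split; first exact: L0_polish.
- exact: L0_not_property_T.
- exact: L0_property_OB.
Qed.
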